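(* There are universal constants $c,C,C_1,C_2>0$ such that the following holds. Let $X,W\in\mathbb{R}^{n\times k}$ and $\mathbf{e}\in\mathbb{R}^n$ be random, following the sub-Gaussian design model with parameters $(\frac1n\Sigma_x,\frac1n)$, $(\frac1n\Sigma_w,\frac1n\sigma_w^2)$ and $(\frac1n\sigma^2,\frac1n\sigma_e^2)$ respectively. Let $\beta^*\in\mathbb{R}^k$, $\mathbf{y}=X\beta^*+\mathbf{e}$ and $Z=X+W$. Let $m\ge k$ and let the instrumental variable $U\in\mathbb{R}^{n\times m}$ be zero-mean sub-Gaussian with parameter $(\frac1n\Sigma_U,\frac1n\sigma_u^2)$, with $\mathbb{E}[U^\top X]=\Sigma_{UX}$, where the pairs formed by the $i$-th rows of $X$ and $U$ are independent over $i=1,\dots,n$ and $(X,U)$, $W$, $\mathbf{e}$ are mutually independent. Let $\sigma_1=\sigma_1(\Sigma_{UX})$ and $\sigma_k=\sigma_k(\Sigma_{UX})>0$ be the first and $k$-th largest singular values of $\Sigma_{UX}$. Let $p\ge k$ and suppose $$n\ge c\,\max\left\{1,\ \frac{\sigma_u^2(1+\sigma_w^2)}{(k/m)\,\sigma_k^2}\right\}k\log p .$$ Then, with probability at least $1-C_1p^{-C_2}$, $\hat\Sigma=Z^\top UU^\top Z$ is invertible and the estimator $\hat\beta=\hat\Sigma^{-1}\hat\gamma$ with $\hat\gamma=Z^\top UU^\top\mathbf{y}$ satisfies $$\|\hat\beta-\beta^*\|_2\le C\,\sqrt{\sigma_w^2\|\beta^*\|_2^2+\sigma_e^2}\ \frac{\sigma_1\sigma_u}{\sigma_k^2\sqrt{k/m}}\sqrt{\frac{k\log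 p}{n}} .$$
   Context: Definitions. A zero-mean real random variable $v$ is sub-Gaussian with parameter $\sigma_v$ if $\mathbb{E}[\exp(\lambda v)]\le\exp(\sigma_v^2\lambda^2/2)$ for all $\lambda\in\mathbb{R}$. A zero-mean random matrix $V$ with $n$ rows and $q$ columns is sub-Gaussian with parameter $(\frac1n\Sigma,\frac1n\sigma^2)$ if (1) its rows $\mathbf{v}_1^\top,\dots,\mathbf{v}_n^\top$ are independent with $\mathbb{E}[\mathbf{v}_i\mathbf{v}_i^\top]=\frac1n\Sigma$ for every $i$, and (2) for every unit vector $\mathbf{u}\in\mathbb{R}^q$, $\mathbf{u}^\top\mathbf{v}_i$ is sub-Gaussian with parameter at most $\frac{1}{\sqrt n}\sigma$. Sub-Gaussian design model: $X$, $W$, $\mathbf{e}$ (the last viewed as an $n\times1$ matrix) are sub-Gaussian with parameters $(\frac1n\Sigma_x,\frac1n)$, $(\frac1n\Sigma_w,\frac1n\sigma_w^2)$, $(\frac1n\sigma^2,\frac1n\sigma_e^2)$ respectively, and are independent of each other. No independence between columns is assumed. Universal constants do not depend on $n,p,k,m$ or any of the variance parameters. $p$ is only a parameter indexing the guarantee. *)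

(* Defs.v *)
From HB Require Import structures.
From mathcomp Require Import all_boot all_order all_algebra.
From mathcomp Require Import polyrcf.
From mathcomp Require Import all_classical all_reals all_analysis.

Set Implicit Arguments.
Unset Strict Implicit.
Unset Printing Implicit Defensive.

Import Order.TTheory GRing.Theory Num.Theory.
Import numFieldNormedType.Exports.

Local Open Scope classical_set_scope.
Local Open Scope ring_scope.

Section LinearAlgebra.
Context {R : realType}.

(* The norm [`|v|] that mathcomp-analysis puts on matrices is the sup norm. *)
Definition l2norm q (v : 'cV[R]_q) : R := Num.sqrt (\sum_i v i ord0 ^+ 2).

(* The real eigenvalues of A, repeated according to their algebraic
   multiplicity, in nonincreasing order ([rootsR] is increasing). *)
Definition eigenvalues q (A : 'M[R]_q) : seq R :=
  rev (flatten [seq nseq (mup x (char_poly A)) x | x <- rootsR (char_poly A)]).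

(* The j-th largest singular value of A, counted from j = 1: the square root
   of the j-th largest eigenvalue of A^T A. *)
Definition singular_value q r (A : 'M[R]_(q, r)) (j : nat) : R :=
  Num.sqrt (nth 0 (eigenvalues (A^T *m A)) j.-1).

Definition Sigma_hat n k m (Z : 'M[R]_(n, k)) (U : 'M[R]_(n, m)) : 'M[R]_k :=
  Z^T *m U *m U^T *m Z.

Definition gamma_hat n k m (Z : 'M[R]_(n, k)) (U : 'M[R]_(n, m))
    (y : 'cV[R]_n) : 'cV[R]_k :=
  Z^T *m U *m U^T *m y.

Definition beta_hat n k m (Z : 'M[R]_(n, k)) (U : 'M[R]_(n, m))
    (y : 'cV[R]_n) : 'cV[R]_k :=
  invmx (Sigma_hat Z U) *m gamma_hat Z U y.

End LinearAlgebra.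

Section Probability.
Context {d : measure_display} {T : measurableType d} {R : realType}.
Variable P : probability T R.

Definition mutually_independent (I : finType) (G : I -> set (set T)) : Prop :=
  forall (J : {set I}) (A : I -> set T),
    (forall i, i \in J -> G i (A i)) ->
    P (\bigcap_(i in [set` J]) A i) = (\prod_(i in J) P (A i))%E.

Definition random_matrix n q (V : T -> 'M[R]_(n, q)) : Prop :=
  forall i j, measurable_fun [set: T] (fun w => V w i j).

Definition sigma_gen n q (V : T -> 'M[R]_(n, q)) : set (set T) :=
  <<s \bigcup_ij g_sigma_algebra_preimage (fun w => V w ij.1 ij.2) >>.

Definition independent_rows n q (V : T -> 'M[R]_(n, q)) : Prop :=
  mutually_independent (fun i : 'I_n => sigma_gen (fun w => row i (V w))).

Definition has_mean n q (V : T -> 'M[R]_(n, q)) (M : 'M[R]_(n, q)) : Prop :=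
  forall i j, 'E_P[fun w => V w i j]%E = (M i j)%:E.

Definition sub_gaussian (v : T -> R) (s : R) : Prop :=
  [/\ measurable_fun [set: T] v,
      'E_P[v]%E = 0%:E,
      0 <= s
    & forall l : R,
        ('E_P[fun w => expR (l * v w)] <= (expR (s ^+ 2 * l ^+ 2 / 2))%:E)%E].

(* V is zero-mean sub-Gaussian with parameter (Sigma / n, sigma ^ 2 / n), n
   being the number of rows of V. *)
Record sub_gaussian_mx n q (V : T -> 'M[R]_(n, q)) (Sigma : 'M[R]_q)
    (sigma : R) : Prop := SubGaussianMx {
  sgmx_random : random_matrix V;
  sgmx_mean0 : has_mean V 0;
  sgmx_rows : independent_rows V;
  (* [row i (V w)] is the transpose of the column vector v_i. *)
  sgmx_cov : forall i,
    has_mean (fun w => (row i (V w))^T *m row i (V w)) (n%:R^-1 *: Sigma);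
  sgmx_tail : forall i (u : 'cV[R]_q), l2norm u = 1 ->
    exists2 s, s <= sigma / Num.sqrt n%:R
             & sub_gaussian (fun w => (u^T *m (row i (V w))^T) ord0 ord0) s
}.

Record sub_gaussian_design n k (X W : T -> 'M[R]_(n, k)) (e : T -> 'cV[R]_n)
    (Sigma_x Sigma_w : 'M[R]_k) (sigma sigma_w sigma_e : R) : Prop :=
  SubGaussianDesign {
  sgd_X : sub_gaussian_mx X Sigma_x 1;
  sgd_W : sub_gaussian_mx W Sigma_w sigma_w;
  sgd_e : sub_gaussian_mx e ((sigma ^+ 2)%:M) sigma_e;
  sgd_indep : mutually_independent
    (tnth [tuple sigma_gen X; sigma_gen W; sigma_gen e])
}.

End Probability.

(* Main.v *)
Require Import Defs.
From HB Require Import structures.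
From mathcomp Require Import all_boot all_order all_algebra.
From mathcomp Require Import all_classical all_reals all_analysis.
From mathcomp Require Import measurable_realfun.
From mathcomp Require Import polyrcf.
From mathcomp Require Import ring lra.

Set Implicit Arguments.
Unset Strict Implicit.
Unset Printing Implicit Defensive.

Import Order.TTheory GRing.Theory Num.Theory.
Import numFieldNormedType.Exports.

Local Open Scope classical_set_scope.
Local Open Scope ring_scope.

(** Write [A = U^T Z] and [v = U^T (e - W beta)]. Since
    [y = Z beta + (e - W beta)], the error [h = beta_hat - beta] solves the normal
    equation [A^T A h = A^T v], so that [|A h| <= |v|]. If [|A x| >= sigma_k / 2 * |x|]
    for all [x], then [Sigma_hat = A^T A] is invertible and
    [|h| <= 2 |v| / sigma_k]; as [sigma_k <= sigma_1] this is even better than the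
    factor [sigma_1 / sigma_k ^ 2] of the claim. This deterministic part is
    [iv_estimator_bound]; the bound [|Sigma_UX x| >= sigma_k |x|] behind it is
    [singular_value_last].

    The matrices [U^T X], [U^T W] and [U^T e] are cross-covariances with means
    [Sigma_UX], 0 and 0. Each is within a constant times
    [sigma_u * s * sqrt (m ln p / n)] of its mean in operator norm, outside an event
    of probability at most [1 / p], where [s] is 1, [sigma_w] or [sigma_e]
    ([cross_covariance_concentration]). The first two bounds and the sample size
    condition give [|A x| >= (sigma_k - sigma_k / 4 - sigma_k / 4) |x|]; the last two
    bound [|v|] by a constant times
    [sigma_u * (sigma_w |beta| + sigma_e) * sqrt (m ln p / n)].

    For fixed directions, the deviation of a cross-covariance is a centered sum of
    [n] independent products of sub-Gaussian variables. If [a] is sub-Gaussian with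
    parameter 1, then [exp (a ^ 2 / 8)] has bounded expectation
    ([integral_expR_sqr]); hence a product of two such variables has an exponential
    moment ([integral_expR_mul]), and its centered moment generating function is at
    most [exp (K mu ^ 2)] near 0 ([mgf_subexp]). Chernoff's method then yields a
    deviation of probability [exp (- C m ln p)] ([bilinear_tail]). This regime
    requires [n >= 256 m ln p], which follows from the sample size condition because
    [sigma_k] is at most a constant times [sigma_u] ([mean_cross_norm]). A union bound
    over a grid of at most [64 ^ q] points in dimension [q] makes the estimate uniform
    in the directions ([grid_operator_norm], [card_grid]). The union is affordable
    since [64 ^ (m + k) <= p ^ (12 m)] for [k <= m] and [p >= 2].

    The independence of rows is used through the expectation of products
    ([integral_prod_independent]); for [W] and [e] the joint independence of the rows
    with those of [U] comes from the independence of the matrices and of their rows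
    ([independent_rows_row_mx]). *)

(** * Measurability of finite sums and products *)

Section MeasurableBig.
Context {d : measure_display} {T : measurableType d} {R : realType}.

Lemma measurable_fun_bigsum (I : Type) (r : seq I) (Q : pred I) (f : I -> T -> R) :
  (forall i, measurable_fun setT (f i)) ->
  measurable_fun setT (fun x => \sum_(i <- r | Q i) f i x).
Proof.
move=> mf; elim: r => [|i r IH].
  by under eq_fun do rewrite big_nil; exact: measurable_cst.
under eq_fun do rewrite big_cons; case: (Q i) => //.
exact: measurable_funD.
Qed.

Lemma measurable_fun_bigprod (I : Type) (r : seq I) (Q : pred I) (f : I -> T -> R) :
  (forall i, measurable_fun setT (f i)) ->
  measurable_fun setT (fun x => \prod_(i <- r | Q i) f i x).
Proof.
move=> mf; elim: r => [|i r IH].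
  by under eq_fun do rewrite big_nil; exact: measurable_cst.
under eq_fun do rewrite big_cons; case: (Q i) => //.
exact: measurable_funM.
Qed.

End MeasurableBig.

(** * Independence and expectations of products *)

Section Independence.
Context {d : measure_display} {T : measurableType d} {R : realType}.
Variable P : probability T R.

Lemma mutually_independent_sub (I : finType) (G H : I -> set (set T)) :
  (forall i, H i `<=` G i) ->
  mutually_independent P G -> mutually_independent P H.
Proof. by move=> HG indG J A HA; apply: indG => i /HA /HG. Qed.

Lemma mutually_independent_full (I : finType) (G : I -> set (set T)) :
  (forall i, G i setT) ->
  (forall A, (forall i, G i (A i)) ->
    P (\bigcap_(i in [set: I]) A i) = (\prod_i P (A i))%E) ->
  mutually_independent P G.
Proof.
move=> GT indG J A GA.
pose B i := if i \in J then A i else setT.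
have GB i : G i (B i) by rewrite /B; case: ifPn => // /GA.
have -> : \bigcap_(i in [set` J]) A i = \bigcap_(i in [set: I]) B i.
  apply/seteqP; split => [x Ax i _|x Bx i /= iJ]; rewrite /B.
    by case: ifPn => // iJ; exact: Ax.
  by have := Bx i Logic.I; rewrite /B iJ.
rewrite indG// [RHS]big_mkcond; apply: eq_bigr => i _; rewrite /B.
by case: ifPn => // _; exact: probability_setT.
Qed.

Lemma mutually_independentT (I : finType) (G : I -> set (set T)) :
  mutually_independent P G -> forall A, (forall i, G i (A i)) ->
  P (\bigcap_(i in [set: I]) A i) = (\prod_i P (A i))%E.
Proof.
move=> indG A GA; have := indG [set: I]%SET A (fun i _ => GA i).
rewrite (_ : [set` [set: I]%SET] = [set: I]); last first.
  by apply/seteqP; split => i //=; rewrite inE.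
by move=> ->; apply: eq_bigl => i; rewrite inE.
Qed.

Lemma bigcapD1 (I : choiceType) (i : I) (A : I -> set T) :
  \bigcap_(j in [set: I]) A j = A i `&` \bigcap_(j in [set j | j != i]) A j.
Proof.
apply/seteqP; split => [x Ax|x [Ai Aj] j _].
  by split => [|j _]; exact: Ax.
by have [->|ji] := eqVneq j i; [|exact: Aj].
Qed.

Lemma finite_bigcap_measurable (I : finType) (D : set I) (A : I -> set T) :
  (forall i, D i -> measurable (A i)) -> measurable (\bigcap_(i in D) A i).
Proof. by move=> mA; apply: fin_bigcap_measurable => //; exact: finite_finset. Qed.

(** The pi-systems are replaced one at a time by the sigma-algebras that they
    generate; one replacement is an instance of the uniqueness of finite measures
    that agree on a pi-system. *)
Lemma mutually_independent_sigma (I : finType) (G : I -> set (set T)) :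
  (forall i, G i setT) -> (forall i, setI_closed (G i)) ->
  (forall i, G i `<=` measurable) ->
  mutually_independent P G -> mutually_independent P (fun i => <<s G i >>).
Proof.
move=> GT GI Gm indG.
have sGm i : <<s G i >> `<=` measurable.
  exact: smallest_sub (@sigma_algebra_measurable _ T) (@Gm i).
pose H (s : seq I) i := if i \in s then <<s G i >> else G i.
have HT s i : H s i setT.
  by rewrite /H; case: ifPn => // _; apply: sub_sigma_algebra.
have Hm s i : H s i `<=` measurable.
  by rewrite /H; case: ifPn => _ //; exact: Gm.
suff HS s : mutually_independent P (H s).
  apply: mutually_independent_sub (HS (enum I)) => i.
  by rewrite /H mem_enum.
elim: s => [|a s IH]; first by apply: mutually_independent_sub indG => i; rewrite /H in_nil.
have [as_|as_] := boolP (a \in s).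
  apply: mutually_independent_sub IH => i; rewrite /H in_cons.
  by have [->|ia] := eqVneq i a => /=; rewrite ?as_ => x.
apply: mutually_independent_full => // A HA.
rewrite (bigD1 a)//= (bigcapD1 a).
have HA' i : i != a -> H s i (A i).
  by move=> ia; have := HA i; rewrite /H in_cons (negPf ia).
have mA i : measurable (A i) by exact: Hm (HA i).
have mC : measurable (\bigcap_(j in [set j | j != a]) A j).
  exact: finite_bigcap_measurable.
set C := \bigcap_(j in _) _ in mC *.
have PC : P C = (\prod_(i | i != a) P (A i))%E.
  have := IH [set i | i != a]%SET A.
  rewrite /C (_ : [set` [set i | i != a]%SET] = [set i | i != a]).
    move=> ->; first by apply: eq_bigl => i; rewrite inE.
    by move=> i; rewrite inE => /HA'.
  by apply/seteqP; split => i /=; rewrite inE.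
have [c PCr] : exists c : {nonneg R}, P C = c%:num%:E.
  have c0 : 0 <= fine (P C) by rewrite fine_ge0.
  by exists (NngNum c0); rewrite /= fineK ?fin_num_measure.
rewrite -PC.
have -> : P (A a `&` C) = mrestr P mC (A a) by [].
have -> : (P (A a) * P C = mscale c P (A a))%E.
  by rewrite muleC PCr.
apply: (g_sigma_algebra_measure_unique (G a) (@Gm a) (fun=> setT)) => //.
- by rewrite bigcup_const//; exists 0%N.
- move=> B GB; transitivity (P B * P C)%E; last by rewrite muleC PCr.
  change (P (B `&` C) = (P B * P C)%E).
  pose B' i := if i == a then B else A i.
  have HB i : H s i (B' i).
    rewrite /B'; case: eqP => [->|/eqP/HA'//].
    by rewrite /H (negPf as_).
  have := mutually_independentT IH HB.
  rewrite (bigcapD1 a) {1}/B' eqxx.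
  have -> : \bigcap_(j in [set j | j != a]) B' j = C.
    by apply: eq_bigcapr => i /= ia; rewrite /B' (negPf ia).
  move=> ->; rewrite (bigD1 a)//= {1}/B' eqxx PC; congr (_ * _)%E.
  by apply: eq_bigr => i ia; rewrite /B' (negPf ia).
- move=> k; change (P (setT `&` C) < +oo)%E.
  by rewrite setTI (le_lt_trans (probability_le1 _ _))// ltry.
- by have := HA a; rewrite /H in_cons eqxx.
Qed.

Import HBNNSimple.

(** The simple functions approximate the absolute value on the real line and are
    then composed with [f], so that their level sets are preimages under [f]. *)
Lemma integral_mul_simple_lim (g f : T -> R) :
  measurable_fun setT g -> (forall x, 0 <= g x) ->
  measurable_fun setT f -> (forall x, 0 <= f x) ->
  forall mh : measurable_fun [set: R] (EFin \o @Num.norm R R),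
  let phi := nnsfun_approx measurableT mh in
  (\int[P]_x (g x * f x)%:E)%E = limn (fun n =>
    \sum_(y \in range (phi n)) (y%:E *
      \int[P]_x (g x * \1_(f @^-1` (phi n @^-1` [set y])) x)%:E))%E.
Proof.
move=> mg g0 mf f0 mh phi.
have phi_nd : nondecreasing_seq (phi : (R -> R)^nat).
  exact: nd_nnsfun_approx.
have phi_cvg x : EFin \o phi^~ (f x) @ \oo --> (f x)%:E.
  have -> : (f x)%:E = (EFin \o @Num.norm R R) (f x) by rewrite /= ger0_norm.
  by apply: cvg_nnsfun_approx => // t _; rewrite lee_fin.
pose F n x := (g x * phi n (f x))%:E.
have mF n : measurable_fun setT (F n).
  apply/measurable_EFinP; apply: measurable_funM => //.
  exact: measurableT_comp.
have -> : (\int[P]_x (g x * f x)%:E = \int[P]_x limn (F^~ x))%E.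
  apply: eq_integral => x _; apply/esym/cvg_lim => //.
  by rewrite EFinM; under eq_fun do rewrite /F EFinM; apply: cvgeZl (phi_cvg x).
rewrite monotone_convergence//; last 2 first.
- by move=> n x _; rewrite lee_fin mulr_ge0.
- move=> x _ n m nm; rewrite lee_fin ler_wpM2l//.
  by have /lefP := phi_nd _ _ nm; exact.
congr (limn _); apply/funext => n.
have m1 y : measurable_fun setT (\1_(f @^-1` (phi n @^-1` [set y])) : T -> R).
  by apply: measurable_indic; rewrite -[_ @^-1` _]setTI; exact: mf.
have E x y : (g x * (y * \1_(phi n @^-1` [set y]) (f x)))%:E =
    (y%:E * (g x * \1_(f @^-1` (phi n @^-1` [set y])) x)%:E)%E.
  by rewrite -EFinM; congr (_%:E); rewrite mulrCA; congr (_ * (_ * _)).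
have G0 x y : 0 <= y * \1_(phi n @^-1` [set y]) (f x).
  by have := nnfun_muleindic_ge0 (phi n) y (f x); rewrite -EFinM lee_fin.
under eq_integral.
  move=> x _; rewrite /F EFinM fimfunE -fsumEFin// ge0_mule_fsumr; last first.
    by move=> y; rewrite lee_fin.
  under eq_fsbigr do rewrite -EFinM E.
  over.
rewrite ge0_integral_fsum//; last 2 first.
- by move=> y; apply/measurable_EFinP; do 2 apply: measurable_funM => //.
- move=> y x _; rewrite -E lee_fin mulr_ge0//.
apply: eq_fsbigr => y; rewrite inE => -[x _ <-]; rewrite ge0_integralZl_EFin//.
- by move=> t _; rewrite lee_fin mulr_ge0.
- by apply/measurable_EFinP; apply: measurable_funM.
Qed.

(** The weighted integral of [f] only involves the weights of events of the form
    [f \in B], the level sets of the simple functions of [f] that increase to [f]. *)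
Lemma eq_integral_mul (g1 g2 f : T -> R) :
  measurable_fun setT g1 -> (forall x, 0 <= g1 x) ->
  measurable_fun setT g2 -> (forall x, 0 <= g2 x) ->
  measurable_fun setT f -> (forall x, 0 <= f x) ->
  (forall B, measurable B -> \int[P]_x (g1 x * \1_(f @^-1` B) x)%:E =
                             \int[P]_x (g2 x * \1_(f @^-1` B) x)%:E)%E ->
  (\int[P]_x (g1 x * f x)%:E = \int[P]_x (g2 x * f x)%:E)%E.
Proof.
move=> mg1 g10 mg2 g20 mf f0 H.
have mh : measurable_fun [set: R] (EFin \o @Num.norm R R).
  by apply/measurable_EFinP.
rewrite (integral_mul_simple_lim mg1 g10 mf f0 mh).
rewrite (integral_mul_simple_lim mg2 g20 mf f0 mh).
congr (limn _); apply/funext => n; apply: eq_fsbigr => y _.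
by rewrite H// -[_ @^-1` _]setTI; exact: measurable_funP.
Qed.

(** Indicators of independent events are replaced by the functions [f i] one
    index at a time; each replacement is [eq_integral_mul], which compares the
    product of the remaining factors with a constant weight. *)
Lemma integral_prod_independent (I : finType) (G : I -> set (set T))
    (f : I -> T -> R) (e : I -> R) :
  mutually_independent P G -> (forall i, G i `<=` measurable) ->
  (forall i, G i setT) ->
  (forall i x, 0 <= f i x) ->
  (forall i B, measurable B -> G i (f i @^-1` B)) ->
  (forall i, \int[P]_x (f i x)%:E = (e i)%:E)%E ->
  (\int[P]_x (\prod_i f i x)%:E = (\prod_i e i)%:E)%E.
Proof.
move=> indG Gm GT f0 fG fe.
have mf i : measurable_fun setT (f i).
  by move=> _ B mB; rewrite setTI; exact: Gm (fG i B mB).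
have e0 i : 0 <= e i.
  by rewrite -lee_fin -fe; apply: integral_ge0 => x _; rewrite lee_fin.
pose phi (s : seq I) (A : I -> set T) i x :=
  if i \in s then f i x else \1_(A i) x.
pose kap (s : seq I) (A : I -> set T) i :=
  if i \in s then e i else fine (P (A i)).
have phi0 s A i x : 0 <= phi s A i x by rewrite /phi; case: ifP.
have kap0 s A i : 0 <= kap s A i by rewrite /kap; case: ifP => // _; rewrite fine_ge0.
suff HS s A : (forall i, G i (A i)) ->
    (\int[P]_x (\prod_i phi s A i x)%:E = (\prod_i kap s A i)%:E)%E.
  have := HS (enum I) (fun=> setT) GT; rewrite /phi /kap.
  under eq_integral do under eq_bigr do rewrite mem_enum.
  by under eq_bigr do rewrite mem_enum.
elim: s A => [|a s IH] A GA.
  rewrite /phi /kap /=.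
  have -> : (fun x => (\prod_i (\1_(A i) x : R))%:E) =
      EFin \o \1_(\bigcap_(i in [set: I]) A i).
    apply/funext => x /=; congr (_%:E); rewrite indicE.
    have [xA|] := boolP (x \in _).
      by rewrite big1// => i _; rewrite indicE mem_set//; have := set_mem xA; exact.
    rewrite notin_setE => xA; have [i xAi] : exists i, ~ A i x.
      by apply/existsNP => H; apply: xA => i _; exact: H.
    by rewrite (bigD1 i)//= indicE memNset// mul0r.
  rewrite integral_indic//; last first.
    by apply: finite_bigcap_measurable => i _; exact: Gm (GA i).
  rewrite setIT [LHS](mutually_independentT indG GA) -prodEFin.
  apply: eq_bigr => i _; rewrite fineK// fin_num_measure//; exact: Gm (GA i).
have [as_|as_] := boolP (a \in s).
  have E i : (i \in a :: s) = (i \in s).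
    by rewrite in_cons; have [->|] := eqVneq i a; rewrite ?as_.
  have -> : phi (a :: s) A = phi s A.
    by apply/funext => i; apply/funext => x; rewrite /phi E.
  have -> : kap (a :: s) A = kap s A by apply/funext => i; rewrite /kap E.
  exact: IH.
pose g x := \prod_(i | i != a) phi s A i x.
pose c := \prod_(i | i != a) kap s A i.
have c0 : 0 <= c by apply: prodr_ge0.
have mphi i : measurable_fun setT (phi s A i).
  rewrite /phi; case: (i \in s); first exact: mf.
  by apply: measurable_indic; exact: Gm (GA i).
transitivity (\int[P]_x (g x * f a x)%:E)%E.
  apply: eq_integral => x _; congr (_%:E); rewrite (bigD1 a)//= mulrC.
  rewrite /phi in_cons eqxx /= /g; congr (_ * _); apply: eq_bigr => i ia.
  by rewrite /phi in_cons (negPf ia).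
rewrite (@eq_integral_mul _ (cst c))//; last 3 first.
- exact: measurable_fun_bigprod.
- by move=> x; apply: prodr_ge0.
- move=> B mB; pose A' i := if i == a then f a @^-1` B else A i.
  have GA' i : G i (A' i) by rewrite /A'; case: eqP => [->|//]; exact: fG.
  transitivity (\int[P]_x (\prod_i phi s A' i x)%:E)%E.
    apply: eq_integral => x _; congr (_%:E); rewrite [RHS](bigD1 a)//= mulrC.
    rewrite {1}/phi (negPf as_) /A' eqxx; congr (_ * _).
    by apply: eq_bigr => i ia; rewrite /phi /A' (negPf ia).
  rewrite IH// (bigD1 a)//= {1}/kap (negPf as_) {1}/A' eqxx.
  have mfB : measurable (f a @^-1` B) by exact: Gm (fG a B mB).
  under [RHS]eq_integral do rewrite EFinM.
  rewrite ge0_integralZl//; last by apply/measurable_EFinP; exact: measurable_indic.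
  rewrite integral_indic// setIT EFinM fineK ?fin_num_measure// muleC.
  congr (_ * _)%E; rewrite /c; congr (_%:E).
  by apply: eq_bigr => i ia; rewrite /kap /A' (negPf ia).
rewrite /=; under eq_integral do rewrite EFinM.
rewrite ge0_integralZl ?lee_fin//; last 2 first.
- exact/measurable_EFinP.
- by move=> x _; rewrite lee_fin.
rewrite fe -EFinM [in RHS](bigD1 a)//= mulrC {1}/kap in_cons eqxx /=.
congr ((_ * _)%:E); apply: eq_bigr => i ia.
by rewrite /kap in_cons (negPf ia).
Qed.

Definition measurable_wrt (G : set (set T)) (f : T -> R) :=
  forall B, measurable B -> G (f @^-1` B).

Lemma measurable_wrt_comp G (phi : R -> R) f :
  measurable_fun setT phi -> measurable_wrt G f -> measurable_wrt G (phi \o f).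
Proof.
move=> mphi Gf B mB; have mB' : measurable (phi @^-1` B).
  by rewrite -[X in measurable X]setTI; exact: mphi.
exact: Gf mB'.
Qed.

(** A centered [f] has [E f^+ = E f^-], so [f^+] and [f^-] give the same mass
    to every event independent of [f]; hence they are interchangeable as weights
    of the positive and negative parts of [g]. *)
Lemma integral_eq0_indep (G H : set (set T)) (f g : T -> R) :
  (forall A B, G A -> H B -> (P (A `&` B) = P A * P B)%E) ->
  G `<=` measurable -> H `<=` measurable ->
  measurable_wrt G f -> measurable_wrt H g ->
  P.-integrable setT (EFin \o f) ->
  P.-integrable setT (EFin \o (f \* g)) ->
  (\int[P]_x (f x)%:E = 0)%E ->
  (\int[P]_x (f x * g x)%:E = 0)%E.
Proof.
move=> GH Gm Hm Gf Hg intf intfg f0.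
have mf : measurable_fun setT f by move=> _ B mB; rewrite setTI; exact/Gm/Gf.
have mg : measurable_fun setT g by move=> _ B mB; rewrite setTI; exact/Hm/Hg.
have [mfp mfn] := (measurable_funrpos mf, measurable_funrneg mf).
have [mgp mgn] := (measurable_funrpos mg, measurable_funrneg mg).
have bnd (h k : T -> R) : P.-integrable setT (EFin \o h) ->
    measurable_fun setT k -> (forall x, `|k x| <= `|h x|) ->
    P.-integrable setT (EFin \o k).
  move=> ih mk kh; apply: le_integrable ih => //; first exact/measurable_EFinP.
  by move=> x _ /=; rewrite lee_fin.
have pos_le (h : T -> R) x : `|h^\+ x| <= `|h x|.
  by rewrite ger0_norm ?funrpos_ge0// /funrpos ge_max ler_norm normr_ge0.
have neg_le (h : T -> R) x : `|h^\- x| <= `|h x|.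
  rewrite ger0_norm ?funrneg_ge0// /funrneg ge_max normr_ge0 andbT.
  by rewrite -normrN ler_norm.
have decomp (h : T -> R) x : h x = h^\+ x - h^\- x.
  by rewrite -[in LHS](funrposBneg h).
have ifn : P.-integrable setT (EFin \o f^\-) by apply: bnd intf mfn (neg_le _).
have eqpn : (\int[P]_x ((f^\+)%R x)%:E = \int[P]_x ((f^\-)%R x)%:E)%E.
  have -> : (fun x => (f^\+ x)%:E) = (EFin \o f) \+ (EFin \o f^\-).
    by apply/funext => x /=; rewrite -EFinD (decomp f x) subrK.
  by rewrite integralD// f0 add0e.
have indic_out phi B : measurable_fun setT phi -> (forall r, 0 <= phi r :> R) ->
    H B -> (\int[P]_x (\1_B x * phi (f x))%:E =
            \int[P]_x (fine (P B) * phi (f x))%:E)%E.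
  move=> mphi phi0 HB; have mB := Hm _ HB.
  apply: (@eq_integral_mul _ (cst (fine (P B))) (phi \o f)) => //.
  - by move=> x; rewrite fine_ge0.
  - exact: measurableT_comp.
  - by move=> x /=.
  - move=> C mC; have GC := measurable_wrt_comp mphi Gf mC.
    have mfC := Gm _ GC.
    transitivity (P ((phi \o f) @^-1` C `&` B)).
      rewrite -[X in P X]setIT -(integral_indic P measurableT)//; last first.
        exact: measurableI.
      by apply: eq_integral => x _; rewrite indicI /= mulrC.
    rewrite GH//=; under [RHS]eq_integral do rewrite EFinM.
    rewrite ge0_integralZl//; last 2 first.
    + by apply/measurable_EFinP; exact: measurable_indic.
    + by rewrite lee_fin fine_ge0.
    by rewrite integral_indic// setIT fineK ?fin_num_measure// muleC.
have maxp : measurable_fun setT (fun r : R => Num.max r 0) by exact: measurable_maxr.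
have maxn : measurable_fun setT (fun r : R => Num.max (- r) 0).
  by apply: measurable_maxr => //; exact: oppr_measurable.
have maxge0 (r : R) : 0 <= Num.max r 0 by rewrite le_max lexx orbT.
have swap phi : measurable_fun setT phi -> (forall r, 0 <= phi r :> R) ->
    (\int[P]_x ((f^\+)%R x * phi (g x))%:E = \int[P]_x ((f^\-)%R x * phi (g x))%:E)%E.
  move=> mphi phi0; apply: (@eq_integral_mul _ _ (phi \o g)) => //.
  - exact: measurableT_comp.
  - by move=> x /=.
  move=> C mC; have HC := measurable_wrt_comp mphi Hg mC.
  have p0 : 0 <= fine (P ((phi \o g) @^-1` C)) by rewrite fine_ge0.
  under eq_integral do rewrite mulrC; under [RHS]eq_integral do rewrite mulrC.
  rewrite (indic_out _ _ maxp)// (indic_out _ _ maxn)//.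
  under eq_integral do rewrite EFinM; under [RHS]eq_integral do rewrite EFinM.
  rewrite !ge0_integralZl//.
  - by rewrite eqpn.
  - exact/measurable_EFinP.
  - by move=> x _; rewrite lee_fin; exact: maxge0.
  - exact/measurable_EFinP.
  - by move=> x _; rewrite lee_fin; exact: maxge0.
pose F (h k : T -> R) : T -> \bar R := EFin \o (h \* k).
have iF (h k : T -> R) : measurable_fun setT h -> measurable_fun setT k ->
   (forall x, `|h x| <= `|f x|) -> (forall x, `|k x| <= `|g x|) ->
   P.-integrable setT (F h k).
  move=> mh mk hf kg; apply: bnd intfg _ _; first exact: measurable_funM.
  by move=> x /=; rewrite !normrM ler_pM.
have ipp := iF _ _ mfp mgp (pos_le f) (pos_le g).
have inp := iF _ _ mfn mgp (neg_le f) (pos_le g).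
have ipn := iF _ _ mfp mgn (pos_le f) (neg_le g).
have inn := iF _ _ mfn mgn (neg_le f) (neg_le g).
have -> : (fun x => (f x * g x)%:E) =
   ((F (f^\+)%R (g^\+)%R \- F (f^\-)%R (g^\+)%R) \- (F (f^\+)%R (g^\-)%R \- F (f^\-)%R (g^\-)%R))%E.
  apply/funext => x; rewrite /F /= -!EFinB; congr (_%:E).
  by rewrite {1}(decomp f x) {1}(decomp g x) -!mulrBl -mulrBr.
rewrite integralB//; [|exact: integrableB|exact: integrableB].
rewrite integralB// [X in (_ - X)%E]integralB//.
have sp : (\int[P]_x F (f^\+)%R (g^\+)%R x = \int[P]_x F (f^\-)%R (g^\+)%R x)%E :=
  swap _ maxp maxge0.
have sn : (\int[P]_x F (f^\+)%R (g^\-)%R x = \int[P]_x F (f^\-)%R (g^\-)%R x)%E :=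
  swap _ maxn (fun r => maxge0 (- r)).
by rewrite sp sn !subee ?sube0//; exact: integrable_fin_num.
Qed.

End Independence.

(** * Sigma-algebras generated by random matrices *)

Section SigmaGen.
Context {d : measure_display} {T : measurableType d} {R : realType}.

Lemma measurable_wrt_sigma (G : set (set T)) (f : T -> R) :
  measurable_wrt <<s G >> f <->
  measurable_fun (setT : set (g_sigma_algebraType G)) (f : g_sigma_algebraType G -> R).
Proof.
split => [Gf _ B mB|mf B mB]; first by rewrite setTI; exact: Gf.
by have := mf measurableT B mB; rewrite setTI.
Qed.

Lemma sigma_gen_entry n q (V : T -> 'M[R]_(n, q)) i j :
  measurable_wrt (sigma_gen V) (fun w => V w i j).
Proof.
move=> B mB; apply: sub_sigma_algebra; exists (i, j) => //=.
by exists B => //; rewrite setTI.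
Qed.

Lemma sigma_gen_setT n q (V : T -> 'M[R]_(n, q)) : sigma_gen V setT.
Proof. exact: (@measurableT _ (g_sigma_algebraType _)). Qed.

Lemma sigma_gen_sub n q n' q' (V : T -> 'M[R]_(n, q)) (V' : T -> 'M[R]_(n', q')) :
  (forall i j, measurable_wrt (sigma_gen V) (fun w => V' w i j)) ->
  sigma_gen V' `<=` sigma_gen V.
Proof.
move=> VV'; apply: smallest_sub; first exact: smallest_sigma_algebra.
move=> A [[i j] _ [B mB <-]]; rewrite setTI; exact: VV'.
Qed.

Lemma sigma_gen_measurable n q (V : T -> 'M[R]_(n, q)) :
  random_matrix V -> sigma_gen V `<=` measurable.
Proof.
move=> mV; apply: smallest_sub; first exact: sigma_algebra_measurable.
move=> A [[i j] _ [B mB <-]]; exact: mV.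
Qed.

Lemma sigma_gen_row n q (V : T -> 'M[R]_(n, q)) i :
  sigma_gen (fun w => row i (V w)) `<=` sigma_gen V.
Proof.
apply: sigma_gen_sub => i' j; under eq_fun do rewrite mxE.
exact: sigma_gen_entry.
Qed.

Lemma random_matrix_row n q (V : T -> 'M[R]_(n, q)) i :
  random_matrix V -> random_matrix (fun w => row i (V w)).
Proof. by move=> mV i' j; under eq_fun do rewrite mxE; exact: mV. Qed.

Lemma random_matrix_row_mx n q m (V : T -> 'M[R]_(n, q)) (U : T -> 'M[R]_(n, m)) :
  random_matrix V -> random_matrix U ->
  random_matrix (fun w => row_mx (V w) (U w)).
Proof.
move=> mV mU i j; case: (split_ordP j) => k ->.
  by under eq_fun do rewrite row_mxEl; exact: mV.
by under eq_fun do rewrite row_mxEr; exact: mU.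
Qed.

Variable P : probability T R.

(** Intersections of an event of the i-th row of [V] with one of the i-th row of
    [U] form a pi-system that generates the events of both rows. *)
Lemma independent_rows_row_mx n q m (V : T -> 'M[R]_(n, q)) (U : T -> 'M[R]_(n, m)) :
  random_matrix V -> random_matrix U ->
  independent_rows P V -> independent_rows P U ->
  (forall A B, sigma_gen V A -> sigma_gen U B -> (P (A `&` B) = P A * P B)%E) ->
  independent_rows P (fun w => row_mx (V w) (U w)).
Proof.
move=> mV mU indV indU VU.
pose SV i := sigma_gen (fun w => row i (V w)).
pose SU i := sigma_gen (fun w => row i (U w)).
have SVm i : SV i `<=` measurable by exact/sigma_gen_measurable/random_matrix_row.
have SUm i : SU i `<=` measurable by exact/sigma_gen_measurable/random_matrix_row.
pose G i : set (set T) := [set C | exists A B, [/\ SV i A, SU i B & C = A `&` B]].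
have GT i : G i setT.
  by exists setT, setT; split; [exact: sigma_gen_setT|exact: sigma_gen_setT|rewrite setIT].
have GI i : setI_closed (G i).
  move=> _ _ [A [B [SA SB ->]]] [A' [B' [SA' SB' ->]]].
  exists (A `&` A'), (B `&` B'); split; last by rewrite setIACA.
    exact: (@measurableI _ (g_sigma_algebraType _)).
  exact: (@measurableI _ (g_sigma_algebraType _)).
have Gm i : G i `<=` measurable.
  by move=> _ [A [B [SA SB ->]]]; apply: measurableI; [exact: (SVm _ _ SA)|exact: (SUm _ _ SB)].
have indG : mutually_independent P G.
  apply: mutually_independent_full => // C GC.
  pose A i := projT1 (cid (GC i)).
  pose B i := projT1 (cid (projT2 (cid (GC i)))).
  have CE i : [/\ SV i (A i), SU i (B i) & C i = A i `&` B i].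
    exact: (projT2 (cid (projT2 (cid (GC i))))).
  have -> : \bigcap_(i in [set: 'I_n]) C i =
      (\bigcap_(i in [set: 'I_n]) A i) `&` (\bigcap_(i in [set: 'I_n]) B i).
    rewrite -bigcapI; apply: eq_bigcapr => i _; by have [_ _ ->] := CE i.
  rewrite VU; last 2 first.
  - apply: (@fin_bigcap_measurable _ (g_sigma_algebraType _)); first exact: finite_finset.
    by move=> i _; have [SA _ _] := CE i; exact: sigma_gen_row SA.
  - apply: (@fin_bigcap_measurable _ (g_sigma_algebraType _)); first exact: finite_finset.
    by move=> i _; have [_ SB _] := CE i; exact: sigma_gen_row SB.
  rewrite (mutually_independentT indV); last by move=> i; case: (CE i).
  rewrite (mutually_independentT indU); last by move=> i; case: (CE i).
  rewrite -big_split /=; apply: eq_bigr => i _; have [SA SB ->] := CE i.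
  by rewrite VU//; [exact: sigma_gen_row SA|exact: sigma_gen_row SB].
apply: mutually_independent_sub (mutually_independent_sigma GT GI Gm indG) => i.
apply: smallest_sub; first exact: smallest_sigma_algebra.
move=> C [[i' j] _ [B mB <-]]; rewrite setTI /=; apply: sub_sigma_algebra.
case: (split_ordP j) => k ->.
- exists ((fun w => V w i k) @^-1` B), setT; split; last 2 first.
  + exact: sigma_gen_setT.
  + by rewrite setIT; under eq_fun do rewrite mxE row_mxEl.
  + have -> : (fun w => V w i k) = (fun w => row i (V w) ord0 k).
      by apply/funext => w; rewrite mxE.
    exact: (@sigma_gen_entry _ _ (fun w => row i (V w))).
- exists setT, ((fun w => U w i k) @^-1` B); split; first exact: sigma_gen_setT.
  + have -> : (fun w => U w i k) = (fun w => row i (U w) ord0 k).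
      by apply/funext => w; rewrite mxE.
    exact: (@sigma_gen_entry _ _ (fun w => row i (U w))).
  + by rewrite setTI; under eq_fun do rewrite mxE row_mxEr.
Qed.

End SigmaGen.

(** * Exponential moments of squares and of products *)

Section ExpBounds.
Context {R : realType}.

Lemma sqr_le_expR (x : R) : 0 <= x -> x ^+ 2 <= 2 * expR x.
Proof.
move=> x0; have := expR_ge1Dxn 1 x0.
have -> : (2`!%:R : R) = 2 by [] .
lra.
Qed.

(** Near 0 this follows from [exp x <= 1 / (1 - x)]; away from 0 the quadratic
    term alone dominates. *)
Lemma expR_le_quadratic (x : R) :
  expR x <= 1 + x + 4 * x ^+ 2 * expR `|x|.
Proof.
have e1 : 1 <= expR `|x| by rewrite -expR0 ler_expR.
have [xs|xb] := leP `|x| (1/2).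
  have [x1 x2] : - (1/2) <= x /\ x <= 1/2 by move: xs; rewrite ler_norml => /andP.
  have h : expR x * (1 - x) <= 1.
    rewrite -ler_pdivlMl ?expR_gt0// mulr1 -expRN.
    by have := expR_ge1Dx (- x).
  have h2 : 0 < 1 - x by lra.
  have h3 : expR x <= (1 - x)^-1 by rewrite -[leRHS]mul1r ler_pdivlMr.
  apply: (le_trans h3).
  have h4 : 1 <= (1 + x + 4 * x ^+ 2) * (1 - x) by nra.
  rewrite -[leLHS]mul1r ler_pdivrMr//; apply: (le_trans h4).
  rewrite ler_pM2r// lerD2l ler_peMr//.
  by rewrite mulr_ge0// sqr_ge0.
have x20 : 0 <= 4 * x ^+ 2 by rewrite mulr_ge0// sqr_ge0.
have xb2 : 1 <= 4 * x ^+ 2.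
  have := xb; rewrite -real_normK ?num_real//; nra.
have [x0|x0] := leP 0 x.
  rewrite (ger0_norm x0); have e0 := expR_ge0 x.
  have : expR x <= 4 * x ^+ 2 * expR x by rewrite ler_peMl.
  lra.
have ex1 : expR x <= 1 by rewrite -expR0 ler_expR ltW.
have : 4 * x ^+ 2 <= 4 * x ^+ 2 * expR `|x| by rewrite ler_peMr.
move: xb; rewrite ltr0_norm// => xb.
have : - x <= 4 * x ^+ 2 by nra.
lra.
Qed.

End ExpBounds.

Section ScalarTail.
Context {d : measure_display} {T : measurableType d} {R : realType}.
Variable P : probability T R.
Local Open Scope ereal_scope.

(** The sum of the geometric series with ratio exp(-1/4) that bounds, term by
    term, the expectation of a series of hyperbolic cosines. *)
Definition square_bound : R :=
  (2 * expR (1/4) / (1 - expR (- (1/4))))%R.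

Lemma square_bound_ge0 : (0 <= square_bound)%R.
Proof.
rewrite /square_bound divr_ge0 ?mulr_ge0 ?expR_ge0// subr_ge0 -expR0 ler_expR.
Qed.

Let weight (j : nat) : R := expR ((j.+1%:R) ^+ 2 / 8 - j%:R ^+ 2).

(** The index is the integer part of [`|x|]: then [x ^ 2 <= (j + 1) ^ 2] and
    [exp (j * `|x|) >= exp (j ^ 2)]. *)
Lemma expR_sqr_le_cosh (x : R) : exists j : nat,
  (expR (x ^+ 2 / 8) <= weight j * (expR (j%:R * x) + expR (- j%:R * x)))%R.
Proof.
exists (Num.truncn `|x|); set j := Num.truncn _.
have /andP[jx xj] : (j%:R <= `|x| < j.+1%:R)%R by rewrite truncn_itv.
have h1 : (expR (j%:R * `|x|) <= expR (j%:R * x) + expR (- j%:R * x))%R.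
  have [x0|x0] := leP 0%R x; first by rewrite ger0_norm// lerDl expR_ge0.
  by rewrite ltr0_norm// mulrN mulNr lerDr expR_ge0.
apply: (le_trans _ (ler_wpM2l (expR_ge0 _) h1)).
rewrite /weight -expRD ler_expR -real_normK ?num_real//.
have : (`|x| ^+ 2 <= j.+1%:R ^+ 2)%R by rewrite ler_pXn2r ?nnegrE// ltW.
have : (j%:R ^+ 2 <= j%:R * `|x|)%R by rewrite expr2 ler_wpM2l.
lra.
Qed.

(** The function exp(x^2/8) is at most a series of hyperbolic cosines cosh(j x)
    with weights exp((j+1)^2/8 - j^2), up to a factor 2. The moment generating
    function bounds the j-th expectation by exp(j^2/2), so the series of
    expectations converges. *)
Lemma integral_expR_sqr (X : T -> R) : measurable_fun setT X ->
  (forall l, \int[P]_x (expR (l * X x))%:E <= (expR (l ^+ 2 / 2))%:E) ->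
  \int[P]_x (expR (X x ^+ 2 / 8))%:E <= square_bound%:E.
Proof.
move=> mX mgf.
pose F (j : nat) x : \bar R :=
  (weight j)%:E * ((expR (j%:R * X x))%:E + (expR (- j%:R * X x))%:E).
have F0 j x : 0 <= F j x.
  by rewrite mule_ge0 ?adde_ge0 ?lee_fin ?expR_ge0.
have mE (l : R) : measurable_fun setT (fun x => (expR (l * X x))%:E).
  apply/measurable_EFinP; apply: measurableT_comp => //.
  exact: measurable_funM.
have mS (j : nat) : measurable_fun setT
    (fun x => (expR (j%:R * X x))%:E + (expR (- j%:R * X x))%:E).
  exact: emeasurable_funD.
have mF j : measurable_fun setT (F j) by exact: measurable_funeM.
have IF j : \int[P]_x F j x <= (geometric (2 * expR (1/4)) (expR (- (1/4))) j)%:E.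
  rewrite ge0_integralZl//; last 2 first.
  - by move=> x _; rewrite adde_ge0 ?lee_fin ?expR_ge0.
  - by rewrite lee_fin expR_ge0.
  rewrite ge0_integralD//.
  apply: (@le_trans _ _ ((weight j)%:E * ((expR (j%:R ^+ 2 / 2))%:E + (expR ((- j%:R) ^+ 2 / 2))%:E))).
    by rewrite lee_pmul2l ?lte_fin ?expR_gt0// leeD.
  rewrite sqrrN -EFinD -EFinM lee_fin /= -expRM_natl -mulr2n.
  rewrite -[(_ *+ 2)%R]mulr_natl mulrCA -!mulrA ler_pM2l// -!expRD ler_expR.
  have j0 : (0 <= (j%:R : R))%R by [].
  have jj : ((j%:R : R) <= j%:R ^+ 2)%R.
    by rewrite -natrX ler_nat; case: (j) => // k; rewrite -mulnn leq_pmull.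
  rewrite -natr1; have := sqr_ge0 (j%:R - 1 : R)%R; nra.
apply: (@le_trans _ _ (\int[P]_x \sum_(j <oo) F j x)).
  apply: ge0_le_integral => //.
  - apply/measurable_EFinP; apply: (measurableT_comp (@measurable_expR R)).
    by apply: measurable_funM => //; exact: measurable_funX.
  - exact: ge0_emeasurable_sum.
  move=> x _; have [j jx] := expR_sqr_le_cosh (X x).
  apply: (@le_trans _ _ (F j x)); first by rewrite /F -EFinD -EFinM lee_fin.
  rewrite (nneseriesD1 (n:=j))//; apply: leeDl; exact: nneseries_ge0.
rewrite integral_nneseries//.
apply: lime_le.
  by apply: is_cvg_nneseries => n _ _; exact: integral_ge0.
apply: nearW => n.
have e1 : (expR (- (1/4)) < 1 :> R)%R by rewrite -[ltRHS]expR0 ltr_expR; lra.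
apply: (@le_trans _ _ (series (geometric (2 * expR (1/4)) (expR (- (1/4)))) n)%:E).
  rewrite /series /= -sumEFin; apply: lee_sum => j _; exact: IF.
rewrite lee_fin; apply: geometric_le_lim => //.
by rewrite ger0_norm ?expR_ge0.
Qed.

End ScalarTail.

(** * Bernstein's inequality for products *)

Section SubExponential.
Context {d : measure_display} {T : measurableType d} {R : realType}.
Variable P : probability T R.
Local Open Scope ereal_scope.

(** Twice the arithmetic-geometric inequality: for [x] and [y], then for the two
    exponentials. *)
Lemma expR_mul_le (x y : R) :
  (expR (`|x * y| / 8) <= 2^-1 * (expR (x ^+ 2 / 8) + expR (y ^+ 2 / 8)))%R.
Proof.
pose a := expR (x ^+ 2 / 16); pose b := expR (y ^+ 2 / 16).
have -> : expR (x ^+ 2 / 8) = (a ^+ 2)%R.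
  by rewrite /a -expRM_natr; congr expR; field.
have -> : expR (y ^+ 2 / 8) = (b ^+ 2)%R.
  by rewrite /b -expRM_natr; congr expR; field.
apply: (@le_trans _ _ (a * b)%R); last by have := sqr_ge0 (a - b)%R; nra.
rewrite /a /b -expRD ler_expR normrM.
rewrite -(real_normK (num_real x)) -(real_normK (num_real y)).
by have := sqr_ge0 (`|x| - `|y|)%R; nra.
Qed.

Lemma measurable_expR_normM (D : T -> R) : measurable_fun setT D ->
  measurable_fun setT (fun x => expR (`|D x| / 8)).
Proof.
move=> mD; apply: (measurableT_comp (@measurable_expR R)).
by apply: measurable_funM => //; exact: measurableT_comp.
Qed.

Lemma measurable_expR_sqr (D : T -> R) : measurable_fun setT D ->
  measurable_fun setT (fun x => expR (D x ^+ 2 / 8)).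
Proof.
move=> mD; apply: (measurableT_comp (@measurable_expR R)).
by apply: measurable_funM => //; exact: measurable_funX.
Qed.

Lemma integral_expR_mul (K : R) (X Y : T -> R) :
  measurable_fun setT X -> measurable_fun setT Y ->
  \int[P]_x (expR (X x ^+ 2 / 8))%:E <= K%:E ->
  \int[P]_x (expR (Y x ^+ 2 / 8))%:E <= K%:E ->
  \int[P]_x (expR (`|X x * Y x| / 8))%:E <= K%:E.
Proof.
move=> mX mY KX KY.
have m1 := measurable_expR_sqr mX; have m2 := measurable_expR_sqr mY.
have m3 : measurable_fun setT
    (fun x => (expR (X x ^+ 2 / 8))%:E + (expR (Y x ^+ 2 / 8))%:E).
  by apply: emeasurable_funD; exact/measurable_EFinP.
apply: (@le_trans _ _ (\int[P]_x ((2^-1)%:E *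
    ((expR (X x ^+ 2 / 8))%:E + (expR (Y x ^+ 2 / 8))%:E)))).
  apply: ge0_le_integral => //.
  - apply/measurable_EFinP/measurable_expR_normM; exact: measurable_funM.
  - exact: measurable_funeM.
  - by move=> x _; rewrite -EFinD -EFinM lee_fin expR_mul_le.
rewrite ge0_integralZl//; last by move=> x _; rewrite adde_ge0 ?lee_fin ?expR_ge0.
rewrite ge0_integralD//; [|exact/measurable_EFinP|exact/measurable_EFinP].
apply: (@le_trans _ _ ((2^-1)%:E * (K%:E + K%:E))).
  by rewrite lee_pmul2l ?lte_fin// leeD.
by rewrite -EFinD -EFinM lee_fin; lra.
Qed.

Section OneVariable.
Variables (K : R) (D : T -> R).
Hypothesis mD : measurable_fun setT D.
Hypothesis KD : \int[P]_x (expR (`|D x| / 8))%:E <= K%:E.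

Let norm_le x : (`|D x| <= 8 * expR (`|D x| / 8))%R.
Proof. by have := expR_ge1Dx (`|D x| / 8); lra. Qed.

Let integrable_exp : P.-integrable setT (fun x => (expR (`|D x| / 8))%:E).
Proof.
apply/integrableP; split; first exact/measurable_EFinP/measurable_expR_normM.
under eq_integral do rewrite gee0_abs ?lee_fin ?expR_ge0//.
by rewrite (le_lt_trans KD)// ltry.
Qed.

Lemma integrable_subexp : P.-integrable setT (EFin \o D).
Proof.
have : P.-integrable setT (fun x => 8%:E * (expR (`|D x| / 8))%:E).
  exact: integrableZl.
apply: le_integrable => //; first exact/measurable_EFinP.
move=> x _ /=; rewrite lee_fin; apply: (le_trans (norm_le x)).
exact: ler_norm.
Qed.

Lemma mean_subexp : `|\int[P]_x (D x)%:E| <= (8 * K)%:E.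
Proof.
apply: (le_trans (le_abse_integral _ measurableT _)); first exact/measurable_EFinP.
apply: (@le_trans _ _ (\int[P]_x (8%:E * (expR (`|D x| / 8))%:E))).
  apply: ge0_le_integral => //.
  - by apply/measurable_EFinP; exact: measurableT_comp.
  - by apply: measurable_funeM; exact/measurable_EFinP/measurable_expR_normM.
  - by move=> x _; rewrite /= lee_fin.
rewrite ge0_integralZl//; last exact/measurable_EFinP/measurable_expR_normM.
by rewrite EFinM lee_pmul2l// ltry.
Qed.

(** Second-order expansion of the exponential: the linear term integrates to the
    mean and exp(|D|/8) absorbs the quadratic remainder. *)
Lemma mgf_subexp (m mu : R) : \int[P]_x (D x)%:E = m%:E -> (`|mu| <= 1/16)%R ->
  \int[P]_x (expR (mu * (D x - m)))%:E <= (expR (2048 * K * mu ^+ 2))%:E.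
Proof.
move=> Dm mu16; pose c := (2048 * mu ^+ 2)%R.
have c0 : (0 <= c)%R by apply: mulr_ge0; [exact: ler0n|exact: sqr_ge0].
have pt x : (expR (mu * D x) <= 1 + mu * D x + c * expR (`|D x| / 8))%R.
  apply: (le_trans (expR_le_quadratic _)); rewrite lerD2l.
  (* 512 = 2 * 16 ^ 2, and 2048 = 4 * 512 with the factor 4 of the expansion. *)
  have h1 : (D x ^+ 2 <= 512 * expR (`|D x| / 16))%R.
    have : (0 <= `|D x| / 16)%R by rewrite divr_ge0.
    by move=> /sqr_le_expR; rewrite exprMn (real_normK (num_real _)); lra.
  have h2 : (expR `|mu * D x| <= expR (`|D x| / 16))%R.
    rewrite ler_expR normrM.
    have : (`|mu| * `|D x| <= 1/16 * `|D x|)%R by rewrite ler_wpM2r.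
    lra.
  have -> : expR (`|D x| / 8) = (expR (`|D x| / 16) * expR (`|D x| / 16))%R.
    by rewrite -expRD; congr expR; field.
  rewrite /c exprMn.
  have h3 : (D x ^+ 2 * expR `|mu * D x| <=
      512 * expR (`|D x| / 16) * expR (`|D x| / 16))%R.
    by apply: ler_pM; [exact: sqr_ge0|exact: expR_ge0| |].
  have := ler_wpM2l c0 h3; rewrite /c; lra.
have -> : \int[P]_x (expR (mu * (D x - m)))%:E =
    (expR (- (mu * m)))%:E * \int[P]_x (expR (mu * D x))%:E.
  rewrite -ge0_integralZl//.
  - by apply: eq_integral => x _; rewrite -EFinM -expRD; congr (expR _)%:E; ring.
  - apply/measurable_EFinP; apply: (measurableT_comp (@measurable_expR R)).
    exact: measurable_funM.
have iD := integrable_subexp.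
have iR : P.-integrable setT
   ((cst 1 \+ (fun x => mu%:E * (EFin \o D) x)) \+ (fun x => c%:E * (expR (`|D x| / 8))%:E)).
  apply: integrableD => //; last exact: integrableZl.
  apply: integrableD => //; last exact: integrableZl.
  exact: finite_measure_integrable_cst.
have H : \int[P]_x (expR (mu * D x))%:E <= (1 + mu * m + c * K)%R%:E.
  apply: (@le_trans _ _ (\int[P]_x ((cst 1 \+ (fun x => mu%:E * (EFin \o D) x)) \+
      (fun x => c%:E * (expR (`|D x| / 8))%:E)) x)).
    apply: ge0_le_integral => //.
    - apply/measurable_EFinP; apply: (measurableT_comp (@measurable_expR R)).
      exact: measurable_funM.
    - exact: (measurable_int P).
    - by move=> x _; rewrite /= -!EFinM -!EFinD lee_fin pt.
  rewrite integralD//; last 2 first.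
  - apply: integrableD => //; last exact: integrableZl.
    exact: finite_measure_integrable_cst.
  - exact: integrableZl.
  rewrite integralD//; last 2 first.
  - exact: finite_measure_integrable_cst.
  - exact: integrableZl.
  rewrite integral_cst//= probability_setT mule1 !integralZl// Dm !EFinD !EFinM leeD2l//.
  by rewrite lee_wpmul2l ?lee_fin.
apply: (@le_trans _ _ ((expR (- (mu * m)))%:E * (1 + mu * m + c * K)%R%:E)).
  by rewrite lee_pmul2l ?lte_fin ?expR_gt0.
rewrite -EFinM lee_fin.
rewrite expRN ler_pdivrMl ?expR_gt0// -expRD.
apply: le_trans (expR_ge1Dx _); rewrite /c; lra.
Qed.

End OneVariable.

(** Markov's inequality for the exponential of the sum; independence factors its
    moment generating function, and [mgf_subexp] bounds each factor. *)
Lemma chernoff_subexp (n : nat) (G : 'I_n -> set (set T)) (D : 'I_n -> T -> R)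
    (m : 'I_n -> R) (K mu t : R) :
  mutually_independent P G -> (forall i, G i `<=` measurable) ->
  (forall i, G i setT) -> (forall i, measurable_wrt (G i) (D i)) ->
  (forall i, \int[P]_x (expR (`|D i x| / 8))%:E <= K%:E) ->
  (forall i, \int[P]_x (D i x)%:E = (m i)%:E) ->
  (0 <= mu <= 1/16)%R ->
  P [set x | t <= \sum_i (D i x - m i)]%R
    <= (expR (2048 * K * mu ^+ 2 * n%:R - mu * t))%:E.
Proof.
move=> indG Gm GT DG DK Dm /andP[mu0 mu16].
have mD i : measurable_fun setT (D i).
  by move=> _ B mB; rewrite setTI; apply: (Gm i); exact: DG.
have mY : measurable_fun setT (fun x => \sum_i (D i x - m i))%R.
  by apply: measurable_fun_bigsum => i; exact: measurable_funB.
pose Y x := (\sum_i (D i x - m i))%R.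
pose f i x := expR (mu * (D i x - m i)).
have bnd i : \int[P]_x (f i x)%:E <= (expR (2048 * K * mu ^+ 2))%:E.
  by apply: mgf_subexp => //; rewrite ger0_norm.
have mphi i : measurable_fun setT (fun r : R => expR (mu * (r - m i))).
  apply: (measurableT_comp (@measurable_expR R)).
  by apply: measurable_funM => //; exact: measurable_funB.
pose e i := fine (\int[P]_x (f i x)%:E).
have eE i : \int[P]_x (f i x)%:E = (e i)%:E.
  rewrite /e fineK// ge0_fin_numE ?(le_lt_trans (bnd i)) ?ltry//.
  by apply: integral_ge0 => x _; rewrite lee_fin expR_ge0.
have prodE : \int[P]_x (\prod_i f i x)%:E = (\prod_i e i)%:E.
  apply: (integral_prod_independent indG) => //.
  - by move=> i x; exact: expR_ge0.
  - by move=> i B mB; exact: (measurable_wrt_comp (mphi i) (DG i)).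
have le_prod : (\prod_i e i <= expR (2048 * K * mu ^+ 2 * n%:R))%R.
  rewrite expRM_natr -[X in (_ ^+ X)%R]card_ord -prodr_const.
  apply: ler_prod => i _; rewrite -!lee_fin -eE bnd andbT.
  by apply: integral_ge0 => x _; rewrite lee_fin expR_ge0.
have mE : measurable [set x | (t <= Y x)%R].
  by rewrite -[X in measurable X]setTI; exact: measurable_fun_le.
apply: (@le_trans _ _ (\int[P]_x ((expR (- (mu * t)))%:E * (\prod_i f i x)%:E))).
  rewrite -[X in P X]setIT -(integral_indic P measurableT mE).
  apply: ge0_le_integral => //.
  - by apply/measurable_EFinP; exact: measurable_indic.
  - apply: measurable_funeM; apply/measurable_EFinP; apply: measurable_fun_bigprod.
    by move=> i; exact: (measurableT_comp (mphi i) (mD i)).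
  - move=> x _; rewrite -EFinM lee_fin indicE /f -expR_sum -mulr_sumr -expRD.
    have [/set_mem /= tY|_] := boolP (x \in _); last exact: expR_ge0.
    rewrite -[leLHS]expR0 ler_expR addrC -mulrBr mulr_ge0// subr_ge0.
    exact: tY.
rewrite ge0_integralZl//.
- by rewrite prodE -EFinM lee_fin addrC expRD ler_wpM2l ?expR_ge0.
- apply/measurable_EFinP; apply: measurable_fun_bigprod.
  by move=> i; exact: (measurableT_comp (mphi i) (mD i)).
- by move=> x _; rewrite lee_fin prodr_ge0// => i _; exact: expR_ge0.
Qed.

End SubExponential.

(** * The Euclidean norm *)

Section EuclideanNorm.
Context {R : realType}.

Definition dot q (u v : 'cV[R]_q) : R := \sum_i u i ord0 * v i ord0.

Lemma dotC q (u v : 'cV[R]_q) : dot u v = dot v u.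
Proof. by apply: eq_bigr => i _; rewrite mulrC. Qed.

Lemma dotDl q (u v w : 'cV[R]_q) : dot (u + v) w = dot u w + dot v w.
Proof. by rewrite /dot -big_split; apply: eq_bigr => i _; rewrite mxE mulrDl. Qed.

Lemma dotZl q a (u v : 'cV[R]_q) : dot (a *: u) v = a * dot u v.
Proof. by rewrite /dot mulr_sumr; apply: eq_bigr => i _; rewrite mxE mulrA. Qed.

Lemma dot0l q (v : 'cV[R]_q) : dot 0 v = 0.
Proof. by rewrite -(scale0r (0 : 'cV[R]_q)) dotZl mul0r. Qed.

Lemma dotDr q (u v w : 'cV[R]_q) : dot w (u + v) = dot w u + dot w v.
Proof. by rewrite dotC dotDl !(dotC w). Qed.

Lemma dotZr q a (u v : 'cV[R]_q) : dot u (a *: v) = a * dot u v.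
Proof. by rewrite dotC dotZl dotC. Qed.

Lemma dot_mulmx q r (A : 'M[R]_(q, r)) u v : dot u (A *m v) = dot (A^T *m u) v.
Proof.
rewrite /dot; under eq_bigr do rewrite mxE mulr_sumr.
rewrite exchange_big; apply: eq_bigr => j _; rewrite mxE mulr_suml.
by apply: eq_bigr => i _; rewrite !mxE mulrCA mulrA.
Qed.

Lemma dot_ge0 q (u : 'cV[R]_q) : 0 <= dot u u.
Proof. by apply: sumr_ge0 => i _; rewrite -expr2 sqr_ge0. Qed.

Lemma l2norm_ge0 q (u : 'cV[R]_q) : 0 <= l2norm u.
Proof. exact: sqrtr_ge0. Qed.

Lemma l2norm_sqr q (u : 'cV[R]_q) : l2norm u ^+ 2 = dot u u.
Proof.
rewrite /l2norm sqr_sqrtr; last by apply: sumr_ge0 => i _; exact: sqr_ge0.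
by apply: eq_bigr => i _; rewrite expr2.
Qed.

Lemma l2norm_le q (u : 'cV[R]_q) b : 0 <= b -> (l2norm u <= b) = (dot u u <= b ^+ 2).
Proof. by move=> b0; rewrite -l2norm_sqr ler_pXn2r// nnegrE l2norm_ge0. Qed.

Lemma l2norm_eq0 q (u : 'cV[R]_q) : l2norm u = 0 -> u = 0.
Proof.
move=> u0; have := l2norm_sqr u; rewrite u0 expr0n => /esym/eqP.
rewrite psumr_eq0 => [/allP uE|i _]; last by rewrite -expr2 sqr_ge0.
apply/colP => i; rewrite mxE; have := uE i (mem_index_enum i).
by rewrite mulf_eq0 orbb => /eqP.
Qed.

Lemma l2norm_gt0 q (u : 'cV[R]_q) : u != 0 -> 0 < l2norm u.
Proof.
move=> u0; rewrite lt_neqAle l2norm_ge0 andbT eq_sym.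
by apply: contraNneq u0 => /l2norm_eq0 ->.
Qed.

Lemma l2norm0 q : l2norm (0 : 'cV[R]_q) = 0.
Proof. by rewrite /l2norm big1 ?sqrtr0// => i _; rewrite mxE expr0n. Qed.

Lemma l2normZ q a (u : 'cV[R]_q) : l2norm (a *: u) = `|a| * l2norm u.
Proof.
rewrite /l2norm -sqrtr_sqr -sqrtrM ?sqr_ge0// mulr_sumr.
by congr Num.sqrt; apply: eq_bigr => i _; rewrite mxE exprMn.
Qed.

Lemma l2norm_normalize q (u : 'cV[R]_q) :
  u != 0 -> l2norm ((l2norm u)^-1 *: u) = 1.
Proof.
move=> u0; have nu : l2norm u != 0.
  by apply/eqP => /l2norm_eq0 E; rewrite E eqxx in u0.
by rewrite l2normZ ger0_norm ?invr_ge0 ?l2norm_ge0// mulVf.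
Qed.

Lemma dot_le_l2norm q (u v : 'cV[R]_q) : dot u v <= l2norm u * l2norm v.
Proof.
have [->|v0] := eqVneq v 0.
  by rewrite l2norm0 mulr0 dotC dot0l.
have nv : 0 < l2norm v by exact: l2norm_gt0.
have := dot_ge0 (l2norm v *: u + (- l2norm u) *: v).
rewrite !(dotDl, dotDr, dotZl, dotZr) -!l2norm_sqr (dotC v u).
have := l2norm_ge0 u; rewrite le_eqVlt => /orP[/eqP nu|nu].
  by rewrite (l2norm_eq0 (esym nu)) l2norm0 !mul0r dot0l.
have nn : 0 < l2norm u * l2norm v by exact: mulr_gt0.
move=> h; have : 0 <= (l2norm u * l2norm v) * (l2norm u * l2norm v - dot u v) by nra.
by rewrite pmulr_rge0// subr_ge0.
Qed.

Lemma l2norm_triangle q (u v : 'cV[R]_q) : l2norm (u + v) <= l2norm u + l2norm v.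
Proof.
have := l2norm_ge0 u; have := l2norm_ge0 v => nv nu.
rewrite l2norm_le ?addr_ge0// !(dotDl, dotDr) -!l2norm_sqr (dotC v u).
by have := dot_le_l2norm u v; nra.
Qed.

End EuclideanNorm.

(** * A finite grid that controls operator norms *)

(** A vector of integers, each given by its sign and its absolute value. *)
Definition grid_index q := {ffun 'I_q -> bool * 'I_(4 * q).+1}.

(** The integer points of squared norm at most [4 * q]. Scaled by
    [(2 * sqrt q)^-1] in [grid_point], they lie in the unit ball. *)
Definition grid q : {set grid_index q} :=
  [set z : grid_index q | (\sum_i (z i).2 ^ 2 <= 4 * q)%N]%SET.

(** Each grid point has [1 <= \prod_i 2 ^ (4 - a_i)], where the [a_i] are the
    absolute values of its coordinates, because [a_i <= a_i ^ 2]. Summing the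
    product over all index vectors gives the q-th power of a geometric sum, at
    most [16 * 2 * 2 = 64]. *)
Lemma card_grid_real (R : realFieldType) q : #|grid q|%:R <= 64%:R ^+ q :> R.
Proof.
have -> : (#|grid q|%:R : R) = \sum_(z in grid q) 1 by rewrite sumr_const.
pose F (p : bool * 'I_(4 * q).+1) : R := 16 * 2^-1 ^+ p.2.
apply: (@le_trans _ _ (\sum_(z : grid_index q) \prod_i F (z i))).
  rewrite [leRHS](bigID (mem (grid q)))/= -[leLHS]addr0 lerD//; last first.
    by apply: sumr_ge0 => z _; apply: prodr_ge0 => i _; rewrite mulr_ge0// exprn_ge0.
  apply: ler_sum => z; rewrite inE => zq.
  have -> : \prod_i F (z i) = 2 ^+ (4 * q) / 2 ^+ (\sum_i (z i).2).
    rewrite big_split /= prodr_const card_ord exprM; congr (_ * _).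
      by congr (_ ^+ q); rewrite -natrX.
    rewrite -exprVn -prodrXr //.
  rewrite ler_pdivlMr ?exprn_gt0// mul1r ler_eXn2l ?ltr1n//.
  apply: leq_trans zq; apply: leq_sum => i _.
  by case: (nat_of_ord _) => // a; rewrite -mulnn leq_pmull.
rewrite -(bigA_distr_bigA (fun=> F)) prodr_const card_ord.
rewrite lerXn2r ?nnegrE//.
  by apply: sumr_ge0 => z _; rewrite mulr_ge0// exprn_ge0.
rewrite /F -(pair_bigA _ (fun (b : bool) (a : 'I_(4 * q).+1) => 16 * 2^-1 ^+ a : R))/=.
rewrite sumr_const card_bool -mulr_sumr.
have -> : \sum_(a < (4 * q).+1) (2^-1 : R) ^+ a = 2 - 2^-1 ^+ (4 * q).
  elim: (4 * q)%N => [|N IH]; first by rewrite big_ord_recr big_ord0 /= expr0; lra.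
  by rewrite big_ord_recr /= IH exprS; lra.
have : 0 <= (2^-1 : R) ^+ (4 * q) by rewrite exprn_ge0.
rewrite -mulr_natl; lra.
Qed.

Lemma card_grid q : (#|grid q| <= 64 ^ q)%N.
Proof. by rewrite -(ler_nat rat) natrX; exact: card_grid_real. Qed.

Section Grid.
Context {R : realType}.

Definition grid_point q (z : grid_index q) : 'cV[R]_q :=
  \col_i ((-1) ^+ (z i).1 * ((z i).2)%:R / (2 * Num.sqrt q%:R)).

Lemma grid_point_norm q z : z \in grid q -> l2norm (grid_point z) <= 1.
Proof.
rewrite inE => zq; rewrite l2norm_le// expr1n.
case: q z zq => [|q] z zq; first by rewrite /dot big_ord0.
have q0 : 0 < (q.+1)%:R :> R by rewrite ltr0n.
have -> : dot (grid_point z) (grid_point z) = (\sum_i (z i).2 ^ 2)%:R / (4 * q.+1)%:R.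
  rewrite natr_sum mulr_suml; apply: eq_bigr => i _; rewrite !mxE natrX natrM.
  rewrite -expr2 !exprMn sqrr_sign mul1r exprVn exprMn sqr_sqrtr ?ltW//.
  by congr (_ / (_ * _)); rewrite -natrX.
by rewrite ler_pdivrMr ?mul1r ?ler_nat// ltr0n muln_gt0.
Qed.

(** Each coordinate of [sqrt q * x] is rounded to one of the two nearest integers,
    the one that does not decrease the linear form. A rounding adds at most 1 to
    the absolute value, so the squared norm stays at most [4 * q]. *)
Lemma grid_rounding q (f x : 'cV[R]_q) : l2norm x <= 1 ->
  exists2 z, z \in grid q & dot f x <= 2 * dot f (grid_point z).
Proof.
move=> x1; have := x1; rewrite l2norm_le// expr1n => xx.
pose y i : R := Num.sqrt q%:R * x i ord0.
have sy : \sum_i y i ^+ 2 <= q%:R.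
  rewrite /y; under eq_bigr do rewrite exprMn sqr_sqrtr// expr2.
  by rewrite -mulr_sumr -[leRHS]mulr1 ler_wpM2l.
pose up i := (0 <= f i ord0 * (-1) ^+ (y i < 0)%R).
pose a i := (Num.truncn `|y i| + up i)%N.
have ay i : (a i)%:R <= `|y i| + 1.
  rewrite /a natrD; apply: lerD; last by case: (up i).
  by have /andP[] : (Num.truncn `|y i|)%:R <= `|y i| < (Num.truncn `|y i|).+1%:R by rewrite truncn_itv.
have sa : (\sum_i a i ^ 2 <= 4 * q)%N.
  rewrite -(ler_nat R) natr_sum.
  apply: (@le_trans _ _ (\sum_(i < q) (2 * y i ^+ 2 + 2))).
    apply: ler_sum => i _; rewrite natrX.
    have a0 : 0 <= (a i)%:R :> R by [].
    have := ay i; rewrite -(real_normK (num_real (y i))).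
    have := sqr_ge0 (`|y i| - 1); have := normr_ge0 (y i); nra.
  rewrite big_split /= -mulr_sumr sumr_const card_ord -mulr_natl natrM; lra.
have aq i : (a i < (4 * q).+1)%N.
  rewrite ltnS; apply: leq_trans sa; rewrite (bigD1 i)//=.
  apply: leq_trans (leq_addr _ _).
  by case: (a i) => // b; rewrite -mulnn leq_pmull.
pose z : grid_index q := [ffun i => ((y i < 0)%R, Ordinal (aq i))].
exists z; first by rewrite inE; under eq_bigr do rewrite ffunE.
rewrite /dot mulr_sumr; apply: ler_sum => i _; rewrite mxE ffunE /=.
have q0 : 0 < q%:R :> R by rewrite ltr0n (leq_ltn_trans _ (ltn_ord i)).
have sq : 0 < Num.sqrt q%:R :> R by rewrite sqrtr_gt0.
have -> : x i ord0 = y i / Num.sqrt q%:R by rewrite /y mulrC mulKf// gt_eqF.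
rewrite mulrA [leRHS](_ : _ = f i ord0 * ((-1) ^+ (y i < 0)%R * (a i)%:R) / Num.sqrt q%:R); last first.
  by field; rewrite gt_eqF.
rewrite ler_pM2r ?invr_gt0// [in leLHS](numEsign (y i)) !mulrA.
have /andP[ty yt] : (Num.truncn `|y i|)%:R <= `|y i| < (Num.truncn `|y i|).+1%:R.
  by rewrite truncn_itv.
rewrite /a /up; have [s0|s0] := leP 0 (f i ord0 * _).
  by rewrite ler_wpM2l// addn1 ltW.
by rewrite addn0 ler_wnM2l// ltW.
Qed.

(** Round first the output direction and then, the rounded output being fixed,
    the input direction. Each rounding costs the factor 2 of [grid_rounding]. *)
Lemma grid_operator_norm m k (N : 'M[R]_(m, k)) t :
  (forall zu zv, zu \in grid m -> zv \in grid k ->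
     dot (grid_point zu) (N *m grid_point zv) <= t) ->
  forall x, l2norm (N *m x) <= 4 * t * l2norm x.
Proof.
move=> Nt x.
have H y v : l2norm y <= 1 -> l2norm v <= 1 -> dot y (N *m v) <= 4 * t.
  move=> y1 v1; have [zu gu] := grid_rounding (N *m v) y1.
  rewrite dotC => /le_trans; apply.
  have [zv gv] := grid_rounding (N^T *m grid_point zu) v1.
  rewrite -!dot_mulmx (dotC (N *m v)) dot_mulmx => h; rewrite -dot_mulmx in h *.
  have := Nt _ _ gu gv; lra.
have [->|x0] := eqVneq x 0; first by rewrite mulmx0 !l2norm0 mulr0.
have nx : 0 < l2norm x by exact: l2norm_gt0.
set y := N *m x.
have [->|y0] := eqVneq y 0.
  rewrite l2norm0; apply: mulr_ge0; last exact: ltW.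
  have := H 0 0; rewrite !l2norm0 mulmx0 => /(_ ler01 ler01).
  by rewrite dot0l.
have ny : 0 < l2norm y by exact: l2norm_gt0.
have := H ((l2norm y)^-1 *: y) ((l2norm x)^-1 *: x).
rewrite !l2norm_normalize// => /(_ (lexx _) (lexx _)).
rewrite -scalemxAr dotZl dotZr -/y -l2norm_sqr => h.
rewrite -ler_pdivrMr//; apply: le_trans h; rewrite le_eqVlt; apply/orP; left.
by apply/eqP; field; rewrite !gt_eqF.
Qed.

End Grid.

(** * The smallest singular value *)

Section Spectrum.
Context {R : realType}.

Lemma mulmx_bounded m k (M : 'M[R]_(m, k)) :
  exists2 c, 0 < c & forall x : 'cV_k, l2norm (M *m x) <= c * l2norm x.
Proof.
pose c2 := \sum_i l2norm ((row i M)^T) ^+ 2.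
have c20 : 0 <= c2 by apply: sumr_ge0 => i _; exact: sqr_ge0.
exists (1 + c2); first by rewrite ltr_pwDl.
move=> x; have x0 := l2norm_ge0 x.
rewrite l2norm_le; last by rewrite mulr_ge0// addr_ge0.
apply: (@le_trans _ _ (c2 * l2norm x ^+ 2)); last first.
  by rewrite exprMn ler_wpM2r ?sqr_ge0//; nra.
rewrite /c2 mulr_suml; apply: ler_sum => i _; rewrite -expr2 -exprMn.
have E : (M *m x) i ord0 = dot (row i M)^T x.
  by rewrite mxE; apply: eq_bigr => j _; rewrite !mxE.
rewrite -real_normK ?num_real// ler_pXn2r ?nnegrE ?mulr_ge0 ?l2norm_ge0//.
rewrite ler_norml E dot_le_l2norm andbT lerNl -mulN1r -dotZl.
by rewrite (le_trans (dot_le_l2norm _ _))// l2normZ normrN1 mul1r.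
Qed.

(** The infimum [mu] of the Rayleigh quotient is an eigenvalue: otherwise
    [S - mu] is invertible and positive semidefinite, hence bounded away from
    zero on the unit sphere. *)
Lemma rayleigh_eigenvalue k (S : 'M[R]_k.+1) : S^T = S ->
  (forall x, 0 <= dot x (S *m x)) ->
  exists2 mu, root (char_poly S) mu &
    forall x, mu * l2norm x ^+ 2 <= dot x (S *m x).
Proof.
move=> symS psdS.
pose Q := [set r | exists2 x : 'cV[R]_k.+1, l2norm x = 1 & r = dot x (S *m x)].
have Q0 : Q !=set0.
  pose e : 'cV[R]_k.+1 := delta_mx ord0 ord0.
  exists (dot e (S *m e)), e => //.
  rewrite /l2norm (bigD1 ord0)//= big1 ?addr0 => [|i i0].
    by rewrite mxE !eqxx expr1n sqrtr1.
  by rewrite mxE (negPf i0) expr0n.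
have lbQ : lbound Q 0 by move=> _ [x _ ->]; exact: psdS.
have infQ : has_inf Q by split => //; exists 0.
pose mu := inf Q.
have B_ge0 (x : 'cV[R]_k.+1) : mu * dot x x <= dot x (S *m x).
  have [->|x0] := eqVneq x 0; first by rewrite !dot0l mulr0.
  have nx : 0 < l2norm x by exact: l2norm_gt0.
  have : mu <= dot ((l2norm x)^-1 *: x) (S *m ((l2norm x)^-1 *: x)).
    apply: ge_inf; first by exists 0.
    by exists ((l2norm x)^-1 *: x) => //; rewrite l2norm_normalize.
  rewrite -scalemxAr dotZl dotZr mulrA -expr2 exprVn => h.
  by rewrite -l2norm_sqr mulrC -ler_pdivlMl ?exprn_gt0.
exists mu; last by move=> x; rewrite l2norm_sqr; exact: B_ge0.
pose B := S - mu%:M.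
have dotB x y : dot x (B *m y) = dot x (S *m y) - mu * dot x y.
  by rewrite mulmxBl mul_scalar_mx -scaleN1r dotDr !dotZr mulN1r.
have [unitB|] := boolP (B \in unitmx); last first.
  rewrite unitmxE unitfE negbK => /det0P[v v0 vB].
  rewrite -eigenvalue_root_char; apply/eigenvalueP; exists v => //.
  by apply/eqP; rewrite -subr_eq0 -mul_mx_scalar -mulmxBr vB.
exfalso.
have [c c0 cB] := mulmx_bounded B.
have [c' c'0 cB'] := mulmx_bounded (invmx B).
have H x : l2norm (B *m x) ^+ 2 <= c * dot x (B *m x).
  set y := B *m x.
  have h1 : dot y (B *m y) <= c * l2norm y ^+ 2.
    apply: (le_trans (dot_le_l2norm _ _)).
    by rewrite mulrC expr2 mulrA ler_wpM2r ?l2norm_ge0.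
  have h2 : dot x (B *m y) = l2norm y ^+ 2.
    by rewrite l2norm_sqr dot_mulmx /B raddfB /= symS tr_scalar_mx.
  (* Cauchy-Schwarz for the semidefinite form of B, at c x - B x. *)
  have h3 : 0 <= dot (c *: x + (-1) *: y) (B *m (c *: x + (-1) *: y)).
    by rewrite dotB subr_ge0 B_ge0.
  move: h3; rewrite mulmxDr -!scalemxAr !(dotDl, dotDr, dotZl, dotZr) h2 -/y -l2norm_sqr => h3.
  have h4 : 0 <= c * (c * dot x y - l2norm y ^+ 2) by nra.
  by move: h4; rewrite pmulr_rge0// subr_ge0.
have H1 x : l2norm x = 1 -> mu + (c' ^+ 2 * c)^-1 <= dot x (S *m x).
  move=> x1; have := H x; rewrite dotB -l2norm_sqr x1 expr1n mulr1 => h.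
  have := cB' (B *m x); rewrite mulKmx// x1 => h2.
  have cc : 0 < c' ^+ 2 * c by rewrite mulr_gt0// exprn_gt0.
  rewrite addrC -lerBrDr -[leLHS]mul1r ler_pdivrMr// mulrC.
  have h3 : 1 <= c' ^+ 2 * l2norm (B *m x) ^+ 2.
    by rewrite -exprMn -[leLHS](expr1n _ 2) ler_pXn2r ?nnegrE ?mulr_ge0 ?l2norm_ge0// ltW.
  apply: (le_trans h3); have := ler_wpM2l (sqr_ge0 c') h; lra.
have : mu + (c' ^+ 2 * c)^-1 <= mu.
  by apply: lb_le_inf => // _ [x x1 ->]; exact: H1.
rewrite gerDl leNgt invr_gt0 mulr_gt0// exprn_gt0//.
Qed.

(** Powers of distinct linear factors are coprime, so their product divides
    [p]. *)
Lemma sum_mup_le (p : {poly R}) (s : seq R) : p != 0 -> uniq s ->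
  (\sum_(x <- s) mup x p <= (size p).-1)%N.
Proof.
move=> p0 us.
have D : \prod_(x <- s) ('X - x%:P) ^+ mup x p %| p.
  elim: s us => [|x s IH] /=; first by rewrite big_nil dvd1p.
  move=> /andP[xs us]; rewrite big_cons Gauss_dvdp; last first.
    apply: coprimep_expl; rewrite coprimep_sym coprimep_XsubC rootE horner_prod.
    rewrite prodf_seq_neq0; apply/allP => y ys /=.
    rewrite horner_exp hornerXsubC expf_neq0// subr_eq0.
    by apply: contraNneq xs => ->.
  by rewrite -mup_geq// leqnn IH.
have := dvdp_leq p0 D.
rewrite size_prod_seq => [|x _]; last by rewrite expf_neq0// polyXsubC_eq0.
under eq_bigr do rewrite size_exp_XsubC.
rewrite -addn1; under eq_bigr do rewrite -addn1; rewrite big_split /=.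
rewrite sum1_size addnAC addnK addn1.
by case: (size p).
Qed.

Lemma sorted_flatten_nseq (f : R -> nat) (s : seq R) :
  sorted <%R s -> sorted <=%R (flatten [seq nseq (f x) x | x <- s]).
Proof.
move=> /(sub_sorted (fun x y => @ltW _ R x y : x < y -> x <= y)).
rewrite !sorted_pairwise; [|exact: le_trans|exact: le_trans].
elim: s => //= x s IH /andP[xs /IH ps]; rewrite pairwise_cat ps andbT.
apply/andP; split.
  apply/allrelP => a b /nseqP[-> _] /flatten_mapP[y ys /nseqP[-> _]].
  exact: (allP xs).
elim: (f x) => //= n ->; rewrite andbT; apply/allP => y /nseqP[-> _].
exact: lexx.
Qed.

Lemma eigenvalues_ge q (A : 'M[R]_q) i j : (i <= j < size (eigenvalues A))%N ->
  nth 0 (eigenvalues A) j <= nth 0 (eigenvalues A) i.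
Proof.
rewrite /eigenvalues; set s := flatten _; rewrite size_rev => /andP[ij js].
have ss : sorted <=%R s by apply: sorted_flatten_nseq; exact: sorted_roots.
rewrite !nth_rev//; last exact: leq_ltn_trans js.
apply: (sorted_leq_nth le_trans le_refl _ ss); rewrite ?inE.
- by rewrite ltn_subrL /=; case: (size s) js.
- by rewrite ltn_subrL /=; case: (size s) js.
- by rewrite leq_sub2l.
Qed.

Lemma size_eigenvalues q (A : 'M[R]_q) : (size (eigenvalues A) <= q)%N.
Proof.
rewrite size_rev size_flatten /shape -map_comp sumnE big_map.
under eq_bigr do rewrite /= size_nseq.
have p0 : char_poly A != 0 by rewrite monic_neq0// char_poly_monic.
have := sum_mup_le p0 (polyrcf.uniq_roots (- cauchy_bound (char_poly A))
  (cauchy_bound (char_poly A)) (char_poly A)).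
by rewrite size_char_poly.
Qed.

Lemma mem_eigenvalues q (A : 'M[R]_q) x :
  root (char_poly A) x -> x \in eigenvalues A.
Proof.
have p0 : char_poly A != 0 by rewrite monic_neq0// char_poly_monic.
move=> rx; rewrite mem_rev; apply/flatten_mapP; exists x.
  by rewrite -roots_on_rootsR.
by rewrite mem_nseq eqxx andbT -XsubC_dvd// dvdp_XsubCl.
Qed.

(** Since [nth] returns 0 beyond the end of a list, a positive k-th entry forces
    [A^T *m A] to have [k] real eigenvalues, the k-th being the smallest one;
    [rayleigh_eigenvalue] does the rest. *)
Lemma singular_value_last m k (A : 'M[R]_(m, k)) : (0 < k)%N ->
  0 < singular_value A k ->
  (forall x, singular_value A k * l2norm x <= l2norm (A *m x)) /\
  singular_value A k <= singular_value A 1.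
Proof.
case: k A => // k A _; rewrite /singular_value sqrtr_gt0 /=.
set S := A^T *m A; set L := eigenvalues S => Lk.
have sL : size L = k.+1.
  apply/eqP; rewrite eqn_leq size_eigenvalues /= ltnNge.
  by apply/negP => sLk; move: Lk; rewrite nth_default ?ltxx.
split; last by rewrite ler_wsqrtr// eigenvalues_ge// -/L sL ltnS leqnn.
have SE x : dot x (S *m x) = l2norm (A *m x) ^+ 2.
  by rewrite -mulmxA dot_mulmx trmxK l2norm_sqr.
have [mu rmu muS] : exists2 mu, root (char_poly S) mu &
    forall x, mu * l2norm x ^+ 2 <= dot x (S *m x).
  apply: rayleigh_eigenvalue; first by rewrite trmx_mul trmxK.
  by move=> x; rewrite SE sqr_ge0.
have Lmu : nth 0 L k <= mu.
  have muL := mem_eigenvalues rmu; rewrite -(nth_index 0 muL).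
  by rewrite eigenvalues_ge// -/L sL leqnn andbT -ltnS -sL index_mem.
move=> x; rewrite -[leRHS]ger0_norm ?l2norm_ge0// -sqrtr_sqr -SE.
rewrite -[l2norm x]ger0_norm ?l2norm_ge0// -sqrtr_sqr -sqrtrM ?(ltW Lk)//.
rewrite ler_wsqrtr// (le_trans _ (muS x))// ler_wpM2r// sqr_ge0//.
Qed.

End Spectrum.

(** * Concentration of bilinear forms in a cross-covariance *)

Section CrossProduct.
Context {d : measure_display} {T : measurableType d} {R : realType}.
Variable P : probability T R.

(** The sub-Gaussian bound with parameter [s / sqrt n], stated on the unit ball
    rather than on the unit sphere so that it applies to grid points. *)
Definition sub_gaussian_rows n q (V : T -> 'M[R]_(n, q)) (s : R) :=
  forall i (u : 'cV[R]_q), l2norm u <= 1 -> forall l : R,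
  (\int[P]_w (expR (l * (V w *m u) i ord0))%:E
     <= (expR (s ^+ 2 * l ^+ 2 / (2 * n%:R)))%:E)%E.

Lemma sub_gaussian_rows_le n q (V : T -> 'M[R]_(n, q)) (s s' : R) :
  0 <= s <= s' -> sub_gaussian_rows V s -> sub_gaussian_rows V s'.
Proof.
move=> /andP[s0 ss'] Vs i u u1 l; apply: (le_trans (Vs i u u1 l)).
rewrite lee_fin ler_expR ler_wpM2r ?invr_ge0 ?mulr_ge0//.
by rewrite ler_wpM2r ?sqr_ge0// ler_pXn2r ?nnegrE// (le_trans s0).
Qed.

Lemma measurable_mulmx n q r (V : T -> 'M[R]_(n, q)) (A : 'M[R]_(q, r)) i j :
  random_matrix V -> measurable_fun setT (fun w => (V w *m A) i j).
Proof.
move=> mV; under eq_fun do rewrite mxE; apply: measurable_fun_bigsum => l.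
by apply: measurable_funM => //; exact: mV.
Qed.

Lemma measurable_dot_cross n m k (V : T -> 'M[R]_(n, k)) (U : T -> 'M[R]_(n, m))
    (M : 'M[R]_(m, k)) u v : random_matrix V -> random_matrix U ->
  measurable_fun setT (fun w => dot u (((U w)^T *m V w - M) *m v)).
Proof.
move=> mV mU; apply: measurable_fun_bigsum => i; apply: measurable_funM => //.
under eq_fun do rewrite mxE; apply: measurable_fun_bigsum => j.
apply: measurable_funM => //; under eq_fun do rewrite !mxE.
apply: measurable_funB => //; apply: measurable_fun_bigsum => l.
by under eq_fun do rewrite mxE; apply: measurable_funM; [exact: mU|exact: mV].
Qed.

Lemma dot_cross n m k (V : 'M[R]_(n, k)) (U : 'M[R]_(n, m)) u v :
  dot u ((U^T *m V) *m v) = \sum_i (U *m u) i ord0 * (V *m v) i ord0.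
Proof. by rewrite -mulmxA dot_mulmx trmxK. Qed.

Lemma finite_union_bound (I : finType) (A : {set I}) (B : I -> set T) (b : R) :
  (forall i, measurable (B i)) -> (forall i, i \in A -> (P (B i) <= b%:E)%E) ->
  0 <= b -> (P (\bigcup_(i in [set` A]) B i) <= (#|A|%:R * b)%:E)%E.
Proof.
move=> mB Bb b0.
have -> : \bigcup_(i in [set` A]) B i = \big[setU/set0]_(i <- enum A) B i.
  by rewrite -bigcup_seq; apply: eq_bigcupl; split => i /=; rewrite mem_enum.
rewrite cardE; have : {subset enum A <= A} by move=> i; rewrite mem_enum.
elim: (enum A) => [|i s IH] sA.
  by rewrite big_nil measure0 mul0r.
rewrite big_cons -nat1r mulrDl mul1r EFinD.
apply: (@le_trans _ _ (P (B i) + P (\big[setU/set0]_(j <- s) B j))%E).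
  by apply: measureU2 => //; apply: bigsetU_measurable => j _; exact: mB.
rewrite leeD ?Bb ?sA ?mem_head// IH// => j js; apply: sA.
by rewrite in_cons js orbT.
Qed.

Section Products.
Variables (n m k : nat) (V : T -> 'M[R]_(n, k)) (U : T -> 'M[R]_(n, m)).
Variables (M : 'M[R]_(m, k)) (alpha beta : R).
Hypotheses (n0 : (0 < n)%N) (a0 : 0 < alpha) (b0 : 0 < beta).
Hypotheses (mV : random_matrix V) (mU : random_matrix U).
Hypotheses (sV : sub_gaussian_rows V beta) (sU : sub_gaussian_rows U alpha).

Let nR0 : 0 < n%:R :> R. Proof. by rewrite ltr0n. Qed.

Let sqn0 : 0 < Num.sqrt n%:R :> R. Proof. by rewrite sqrtr_gt0. Qed.

Lemma standardized_rows q (Z : T -> 'M[R]_(n, q)) (s : R) u i :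
  0 < s -> random_matrix Z -> sub_gaussian_rows Z s -> l2norm u <= 1 ->
  (\int[P]_w (expR ((Num.sqrt n%:R / s * (Z w *m u) i ord0) ^+ 2 / 8))%:E
    <= (square_bound : R)%:E)%E.
Proof.
move=> s0 mZ sZ u1; apply: integral_expR_sqr.
  by apply: measurable_funM => //; exact: measurable_mulmx.
move=> l; have := sZ i u u1 (l * (Num.sqrt n%:R / s)).
under eq_integral do rewrite -mulrA.
move=> /le_trans; apply; rewrite lee_fin ler_expR le_eqVlt; apply/orP; left.
rewrite !exprMn exprVn sqr_sqrtr ?ltW//; apply/eqP; field.
by rewrite !gt_eqF.
Qed.

(** The factors [sqrt n / alpha] and [sqrt n / beta] standardize the two linear
    forms to the sub-Gaussian parameter 1. *)
Definition row_product (u : 'cV[R]_m) (v : 'cV[R]_k) (i : 'I_n) (w : T) : R :=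
  (Num.sqrt n%:R / alpha * (U w *m u) i ord0) *
  (Num.sqrt n%:R / beta * (V w *m v) i ord0).

Lemma row_productE u v i w : (U w *m u) i ord0 * (V w *m v) i ord0 =
  alpha * beta / n%:R * row_product u v i w.
Proof.
have e : Num.sqrt n%:R * Num.sqrt n%:R = n%:R :> R by rewrite -expr2 sqr_sqrtr// ltW.
rewrite /row_product; move: e sqn0; move: (Num.sqrt _) => r <- r0.
by field; rewrite !gt_eqF.
Qed.

Lemma measurable_row_product u v i : measurable_fun setT (row_product u v i).
Proof.
by apply: measurable_funM; apply: measurable_funM => //; exact: measurable_mulmx.
Qed.

Lemma row_product_subexp u v i : l2norm u <= 1 -> l2norm v <= 1 ->
  (\int[P]_w (expR (`|row_product u v i w| / 8))%:E <= (square_bound : R)%:E)%E.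
Proof.
move=> u1 v1; apply: integral_expR_mul.
- by apply: measurable_funM => //; exact: measurable_mulmx.
- by apply: measurable_funM => //; exact: measurable_mulmx.
- exact: standardized_rows.
- exact: standardized_rows.
Qed.

Definition row_product_mean u v i : R := fine (\int[P]_w (row_product u v i w)%:E)%E.

Lemma row_product_meanE u v i : l2norm u <= 1 -> l2norm v <= 1 ->
  (\int[P]_w (row_product u v i w)%:E = (row_product_mean u v i)%:E)%E.
Proof.
move=> u1 v1; rewrite fineK//; apply: integrable_fin_num => //.
exact: (integrable_subexp (measurable_row_product u v i) (row_product_subexp i u1 v1)).
Qed.

Lemma integrable_row_mul u v i : l2norm u <= 1 -> l2norm v <= 1 ->
  P.-integrable setT (fun w => ((U w *m u) i ord0 * (V w *m v) i ord0)%:E).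
Proof.
move=> u1 v1; under eq_fun do rewrite row_productE EFinM.
apply: integrableZl => //.
exact: (integrable_subexp (measurable_row_product u v i) (row_product_subexp i u1 v1)).
Qed.

Lemma integrable_cross u v : l2norm u <= 1 -> l2norm v <= 1 ->
  P.-integrable setT (fun w => (dot u (((U w)^T *m V w) *m v))%:E).
Proof.
move=> u1 v1; under eq_fun do rewrite dot_cross -sumEFin.
by apply: integrable_sum => // i _; exact: integrable_row_mul.
Qed.

Lemma l2norm_delta q (j : 'I_q) : l2norm (delta_mx j ord0 : 'cV[R]_q) = 1.
Proof.
rewrite /l2norm (bigD1 j)//= big1 ?addr0 => [|i ij].
  by rewrite mxE !eqxx expr1n sqrtr1.
by rewrite mxE (negPf ij) expr0n.
Qed.

Lemma dot_delta q r (A : 'M[R]_(q, r)) i j :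
  dot (delta_mx i ord0) (A *m delta_mx j ord0) = A i j.
Proof.
rewrite -colE /dot (bigD1 i)//= big1 ?addr0 => [|l li].
  by rewrite !mxE !eqxx mul1r.
by rewrite !mxE (negPf li) mul0r.
Qed.

Lemma dot_sum q r (A : 'M[R]_(q, r)) u v :
  dot u (A *m v) = \sum_i \sum_j u i ord0 * v j ord0 * A i j.
Proof.
apply: eq_bigr => i _; rewrite mxE mulr_sumr; apply: eq_bigr => j _.
by rewrite (mulrC (A i j)) mulrA.
Qed.

Lemma integrable_cross_entry j l :
  P.-integrable setT (fun w => (((U w)^T *m V w) j l)%:E).
Proof.
have := @integrable_cross (delta_mx j ord0) (delta_mx l ord0).
by under eq_fun do rewrite dot_delta; rewrite !l2norm_delta; apply.
Qed.

Hypothesis UVM : has_mean P (fun w => (U w)^T *m V w) M.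

Lemma mean_cross u v : (\int[P]_w (dot u (((U w)^T *m V w) *m v))%:E = (dot u (M *m v))%:E)%E.
Proof.
under eq_integral do rewrite dot_sum -sumEFin.
have iA j l : P.-integrable setT (fun w => (u j ord0 * v l ord0 * ((U w)^T *m V w) j l)%:E).
  by under eq_fun do rewrite EFinM; apply: integrableZl => //; exact: integrable_cross_entry.
rewrite integral_sum//; last first.
  move=> j; under eq_fun do rewrite -sumEFin.
  by apply: integrable_sum.
rewrite dot_sum -sumEFin; apply: eq_bigr => j _.
under eq_integral do rewrite -sumEFin.
rewrite integral_sum// -sumEFin; apply: eq_bigr => l _.
under eq_integral do rewrite EFinM.
rewrite integralZl//; last exact: integrable_cross_entry.
by have := UVM j l; rewrite unlock => ->.
Qed.

Lemma sum_row_product_mean u v : l2norm u <= 1 -> l2norm v <= 1 ->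
  alpha * beta / n%:R * (\sum_i row_product_mean u v i) = dot u (M *m v).
Proof.
move=> u1 v1; apply: EFin_inj; rewrite -mean_cross.
under eq_integral do rewrite dot_cross -sumEFin.
rewrite integral_sum//; last by move=> i; exact: integrable_row_mul.
rewrite mulr_sumr -sumEFin; apply: eq_bigr => i _.
under eq_integral do rewrite row_productE EFinM.
rewrite integralZl//; last first.
  exact: (integrable_subexp (measurable_row_product u v i) (row_product_subexp i u1 v1)).
by rewrite row_product_meanE.
Qed.

Lemma mean_cross_bound u v : l2norm u <= 1 -> l2norm v <= 1 ->
  dot u (M *m v) <= 8 * square_bound * (alpha * beta).
Proof.
move=> u1 v1; rewrite -sum_row_product_mean//.
have ab : 0 <= alpha * beta / n%:R by rewrite divr_ge0// mulr_ge0// ltW.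
apply: (@le_trans _ _ (alpha * beta / n%:R * \sum_(i < n) (8 * square_bound))).
  rewrite ler_wpM2l//; apply: ler_sum => i _.
  have := mean_subexp (measurable_row_product u v i) (row_product_subexp i u1 v1).
  rewrite row_product_meanE// abse_EFin lee_fin; apply: le_trans; exact: ler_norm.
rewrite sumr_const card_ord -mulr_natl le_eqVlt; apply/orP; left.
by apply/eqP; field; rewrite gt_eqF.
Qed.

Hypothesis indVU : independent_rows P (fun w => row_mx (V w) (U w)).

Definition bernstein_const : R := 2048 * square_bound.

Lemma measurable_wrt_row u v i :
  measurable_wrt (sigma_gen (fun w => row i (row_mx (V w) (U w)))) (row_product u v i).
Proof.
have -> : row_product u v i = (fun w =>
    (Num.sqrt n%:R / alpha * (\sum_j U w i j * u j ord0)) *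
    (Num.sqrt n%:R / beta * (\sum_j V w i j * v j ord0))).
  by apply/funext => w; rewrite /row_product !mxE.
set S := sigma_gen _.
have entryU j : measurable_wrt S (fun w => U w i j).
  have -> : (fun w => U w i j) = (fun w => row i (row_mx (V w) (U w)) ord0 (rshift k j)).
    by apply/funext => w; rewrite mxE row_mxEr.
  exact: (@sigma_gen_entry _ _ _ _ _ (fun w => row i (row_mx (V w) (U w)))).
have entryV j : measurable_wrt S (fun w => V w i j).
  have -> : (fun w => V w i j) = (fun w => row i (row_mx (V w) (U w)) ord0 (lshift m j)).
    by apply/funext => w; rewrite mxE row_mxEl.
  exact: (@sigma_gen_entry _ _ _ _ _ (fun w => row i (row_mx (V w) (U w)))).
apply/measurable_wrt_sigma.
apply: measurable_funM; apply: measurable_funM => //; apply: measurable_fun_bigsum => j.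
- by apply: measurable_funM => //; apply/measurable_wrt_sigma; exact: entryU.
- by apply: measurable_funM => //; apply/measurable_wrt_sigma; exact: entryV.
Qed.

(** The centered bilinear form is [alpha * beta / n] times a sum of [n] independent
    centered products of standardized sub-Gaussian variables. *)
Lemma bilinear_tail u v (L C : R) : l2norm u <= 1 -> l2norm v <= 1 ->
  0 <= L -> 256 * L <= n%:R ->
  (P [set w | C * (alpha * beta) * Num.sqrt (L / n%:R)
        <= dot u (((U w)^T *m V w - M) *m v)]%R
    <= (expR ((bernstein_const - C) * L))%:E)%E.
Proof.
move=> u1 v1 L0 Ln; set s := Num.sqrt (L / n%:R).
have Ln0 : 0 <= L / n%:R by rewrite divr_ge0// ltW.
have ns : n%:R * s ^+ 2 = L by rewrite sqr_sqrtr// mulrC divfK// gt_eqF.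
(* With the Chernoff parameter s = sqrt (L / n), the exponent is a multiple of L. *)
have s16 : 0 <= s <= 1/16.
  rewrite sqrtr_ge0 /= -(@ler_pXn2r _ 2%N)// ?nnegrE ?sqrtr_ge0//.
  by rewrite sqr_sqrtr// ler_pdivrMr//; lra.
have H : (P [set w | n%:R * (C * s) <=
      \sum_i (row_product u v i w - row_product_mean u v i)]%R
    <= (expR (2048 * square_bound * s ^+ 2 * n%:R - s * (n%:R * (C * s))))%:E)%E.
  apply: (@chernoff_subexp _ _ _ P n
    (fun i => sigma_gen (fun w => row i (row_mx (V w) (U w))))
    (row_product u v) (row_product_mean u v) square_bound s) => //.
  - by move=> i; apply/sigma_gen_measurable/random_matrix_row/random_matrix_row_mx.
  - by move=> i; exact: sigma_gen_setT.
  - by move=> i; exact: measurable_wrt_row.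
  - by move=> i; exact: row_product_subexp.
  - by move=> i; exact: row_product_meanE.
have -> : (bernstein_const - C) * L =
    2048 * square_bound * s ^+ 2 * n%:R - s * (n%:R * (C * s)).
  by rewrite -ns /bernstein_const; ring.
apply: le_trans H; rewrite le_eqVlt; apply/orP; left; apply/eqP; congr (P _).
have E w : dot u (((U w)^T *m V w - M) *m v) = alpha * beta / n%:R *
    \sum_i (row_product u v i w - row_product_mean u v i).
  rewrite sumrB mulrBr sum_row_product_mean// mulmxBl -scaleN1r dotDr dotZr mulN1r.
  by rewrite dot_cross mulr_sumr; under eq_bigr do rewrite row_productE.
apply/funext => w /=; rewrite E.
have ab : 0 < alpha * beta / n%:R by rewrite divr_gt0// mulr_gt0.
have -> : C * (alpha * beta) * s = alpha * beta / n%:R * (n%:R * (C * s)).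
  by field; rewrite gt_eqF.
by rewrite ler_pM2l.
Qed.

End Products.

End CrossProduct.

(** * Concentration of a cross-covariance in operator norm *)

Section OperatorNorm.
Context {d : measure_display} {T : measurableType d} {R : realType}.
Variable P : probability T R.

Lemma measurable_lt_set (c : R) (Y : T -> R) :
  measurable_fun setT Y -> measurable [set w | c < Y w].
Proof.
move=> mY; have -> : [set w | c < Y w] = ~` [set w | Y w <= c].
  by apply/seteqP; split => w /=; rewrite ltNge => /negP.
apply: measurableC; rewrite -[X in measurable X]setTI.
exact: measurable_fun_le.
Qed.

(** Standardization needs [beta > 0]. For [beta = 0], the event is contained in
    the increasing union of the events with parameters [beta + 1 / (j + 1)]. *)
Lemma bilinear_tail_ge0 n m k (V : T -> 'M[R]_(n, k)) (U : T -> 'M[R]_(n, m))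
    (M : 'M[R]_(m, k)) (alpha beta : R) u v (L C : R) :
  (0 < n)%N -> 0 < alpha -> 0 <= beta ->
  random_matrix V -> random_matrix U ->
  sub_gaussian_rows P V beta -> sub_gaussian_rows P U alpha ->
  has_mean P (fun w => (U w)^T *m V w) M ->
  independent_rows P (fun w => row_mx (V w) (U w)) ->
  l2norm u <= 1 -> l2norm v <= 1 ->
  0 < L -> 256 * L <= n%:R -> 0 < C ->
  (P [set w | C * (alpha * beta) * Num.sqrt (L / n%:R)
        < dot u (((U w)^T *m V w - M) *m v)]%R
    <= (expR ((bernstein_const - C) * L))%:E)%E.
Proof.
move=> n0 a0 b0 mV mU sV sU UVM indVU u1 v1 L0 Ln C0.
pose Y w := dot u (((U w)^T *m V w - M) *m v).
pose s := Num.sqrt (L / n%:R).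
have s0 : 0 < s by rewrite sqrtr_gt0 divr_gt0// ltr0n.
have Cas : 0 < C * alpha * s by rewrite !mulr_gt0.
have mY : measurable_fun setT Y by exact: measurable_dot_cross.
pose bt (j : nat) := beta + j.+1%:R^-1.
pose F (j : nat) := [set w | C * (alpha * bt j) * s <= Y w].
have mF j : measurable (F j).
  by rewrite -[X in measurable X]setTI; exact: measurable_fun_le.
have mUF : measurable (\bigcup_j F j) by exact: bigcupT_measurable.
have PF j : (P (F j) <= (expR ((bernstein_const - C) * L))%:E)%E.
  have bj : 0 < bt j by rewrite ltr_wpDl// invr_gt0.
  apply: (bilinear_tail n0 a0 bj mV mU _ sU UVM indVU) => //; last exact: ltW.
  by apply: sub_gaussian_rows_le sV; rewrite b0 /bt lerDl invr_ge0 ler0n.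
have ndF : nondecreasing_seq F.
  move=> i j ij; apply/subsetPset => w /=; apply: le_trans.
  rewrite ler_wpM2r ?(ltW s0)// ler_wpM2l ?(ltW C0)// ler_wpM2l ?(ltW a0)//.
  by rewrite lerD2l lef_pV2 ?posrE ?ltr0n// ler_nat.
apply: (@le_trans _ _ (P (\bigcup_j F j))).
  apply: le_measure; rewrite ?inE//.
    exact: measurable_lt_set.
  move=> w /= Cw; have : beta < Y w / (C * alpha * s).
    rewrite ltr_pdivlMr//; apply: le_lt_trans Cw.
    by rewrite le_eqVlt -/s; apply/orP; left; apply/eqP; ring.
  move=> /ltr_add_invr[j]; rewrite ltr_pdivlMr// => /ltW jY; exists j => //=.
  apply: le_trans jY; rewrite le_eqVlt; apply/orP; left; apply/eqP.
  by rewrite /bt; ring.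
have cF : P \o F @ \oo --> P (\bigcup_j F j) by exact: nondecreasing_cvg_mu.
rewrite -(cvg_lim _ cF)//; apply: lime_le; first by apply/cvg_ex; eexists; exact: cF.
by apply: nearW => j; exact: PF.
Qed.

(** Of the excess 13 over [bernstein_const], 12 pays for the pairs of grid points
    and 1 leaves the failure probability [p^-1]. *)
Definition deviation_const : R := bernstein_const + 13.

Lemma deviation_const_gt0 : 0 < deviation_const.
Proof.
apply: ltr_wpDl; last by rewrite ltr0n.
by apply: mulr_ge0; [exact: ler0n|exact: square_bound_ge0].
Qed.

(** [64 ^ (m + k) <= 64 ^ (2 * m) = 2 ^ (12 * m) <= p ^ (12 * m)], while the
    exponential is [p ^ (- 13 * m)]. *)
Lemma grid_union_le m k p (L : R) : (k <= m)%N -> (0 < m)%N -> (2 <= p)%N ->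
  L = m%:R * ln p%:R ->
  (#|grid m|)%:R * (#|grid k|)%:R * expR ((bernstein_const - deviation_const) * L)
    <= p%:R^-1.
Proof.
move=> km m0 p2 ->.
have p0 : (0 < p%:R :> R) by rewrite ltr0n (leq_trans _ p2).
have -> : (bernstein_const - deviation_const) * (m%:R * ln p%:R) =
    - ((13 * m)%N%:R * ln p%:R).
  by rewrite /deviation_const natrM; ring.
rewrite expRN expRM_natl lnK ?posrE// -natrM -!natrX.
rewrite ler_pdivrMr ?ltr0n ?expn_gt0 ?(leq_trans _ p2)//.
rewrite -(@ler_pM2l _ p%:R)// mulrA mulfV ?gt_eqF// mul1r -natrM ler_nat.
apply: (@leq_trans (p * (p ^ (12 * m)))%N); last first.
  by rewrite -expnS leq_exp2l// mulSn -add1n leq_add.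
rewrite leq_pmul2l ?(leq_trans _ p2)//.
apply: (@leq_trans (64 ^ m * 64 ^ m)%N).
  apply: leq_mul; first exact: card_grid.
  by apply: (leq_trans (card_grid k)); rewrite leq_exp2l.
rewrite -expnMn expnM leq_exp2r//.
by apply: (@leq_trans (2 ^ 12)%N) => //; rewrite leq_exp2r.
Qed.

(** Union bound of [bilinear_tail_ge0] over the pairs of grid points; by
    [grid_operator_norm] the bounds on the grid control all directions. The event
    [E] is measurable as a finite intersection over the grid. *)
Lemma cross_covariance_concentration n m k p (V : T -> 'M[R]_(n, k))
    (U : T -> 'M[R]_(n, m)) (M : 'M[R]_(m, k)) (alpha beta : R) :
  (0 < n)%N -> (0 < m)%N -> (k <= m)%N -> (2 <= p)%N ->
  256 * (m%:R * ln p%:R) <= n%:R :> R ->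
  0 < alpha -> 0 <= beta ->
  random_matrix V -> random_matrix U ->
  sub_gaussian_rows P V beta -> sub_gaussian_rows P U alpha ->
  has_mean P (fun w => (U w)^T *m V w) M ->
  independent_rows P (fun w => row_mx (V w) (U w)) ->
  exists E : set T, [/\ measurable E, (P (~` E) <= (p%:R^-1)%:E)%E &
    forall w, E w -> forall x : 'cV[R]_k,
      l2norm (((U w)^T *m V w - M) *m x) <=
      4 * (deviation_const * (alpha * beta) * Num.sqrt (m%:R * ln p%:R / n%:R)) * l2norm x].
Proof.
move=> n0 m0 km p2 Ln a0 b0 mV mU sV sU UVM indVU.
set L := m%:R * ln p%:R in Ln *.
have L0 : 0 < L by rewrite mulr_gt0 ?ltr0n// ln_gt0// ltr1n.
set t := deviation_const * (alpha * beta) * _.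
have C0 := deviation_const_gt0.
pose B (z : grid_index m * grid_index k) := [set w |
  t < dot (grid_point z.1) (((U w)^T *m V w - M) *m grid_point z.2)].
have mB z : measurable (B z).
  by apply: measurable_lt_set; exact: measurable_dot_cross.
pose A : {set grid_index m * grid_index k} := finset.setX (grid m) (grid k).
have mBU : measurable (\bigcup_(z in [set` A]) B z).
  by apply: fin_bigcup_measurable => //; exact: finite_finset.
exists (~` \bigcup_(z in [set` A]) B z); split.
- exact: measurableC.
- rewrite setCK; apply: le_trans (finite_union_bound mB _ (expR_ge0 _)) _.
    move=> [zu zv]; rewrite /A inE /= => /andP[gu gv].
    exact: (bilinear_tail_ge0 n0 a0 b0 mV mU sV sU UVM indVU
      (grid_point_norm gu) (grid_point_norm gv) L0 Ln C0).
  by rewrite lee_fin /A cardsX natrM; exact: grid_union_le.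
- move=> w Ew; apply: grid_operator_norm => zu zv gu gv.
  rewrite leNgt; apply/negP => h; apply: Ew; exists (zu, zv) => //=.
  by rewrite /A inE gu gv.
Qed.

End OperatorNorm.

(** * The error of the estimator for given data *)

Section LeastSquares.
Context {R : realType}.
Variables (m k : nat) (A : 'M[R]_(m, k)) (s : R).
Hypothesis s0 : 0 < s.
Hypothesis As : forall x, s * l2norm x <= l2norm (A *m x).

Lemma gram_unitmx : A^T *m A \in unitmx.
Proof.
rewrite unitmxE unitfE; apply/negP => /det0P[v v0 vA].
have Av : dot v^T (A^T *m A *m v^T) = 0.
  have -> : A^T *m A *m v^T = (v *m (A^T *m A))^T by rewrite !trmx_mul trmxK.
  by rewrite vA trmx0 dotC dot0l.
have := As v^T; rewrite -mulmxA dot_mulmx trmxK -l2norm_sqr in Av.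
move/eqP: Av; rewrite expf_eq0 /= => /eqP ->.
rewrite pmulr_rle0// => h; have /l2norm_eq0 : l2norm v^T = 0.
  by apply/eqP; rewrite eq_le h l2norm_ge0.
by move=> /(congr1 trmx); rewrite trmxK trmx0 => vE; rewrite vE eqxx in v0.
Qed.

(** The normal equation gives [dot (A h) (A h) = dot (A h) v]. *)
Lemma normal_equation_bound h v : A^T *m A *m h = A^T *m v ->
  s * l2norm h <= l2norm v.
Proof.
move=> hv; apply: le_trans (As h) _.
have : l2norm (A *m h) ^+ 2 <= l2norm (A *m h) * l2norm v.
  by rewrite l2norm_sqr dot_mulmx mulmxA hv -dot_mulmx dotC dot_le_l2norm.
have := l2norm_ge0 (A *m h); rewrite le_eqVlt => /orP[/eqP <-|Ah0].
  by move=> _; exact: l2norm_ge0.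
by rewrite expr2 ler_pM2l.
Qed.

End LeastSquares.

Section Estimator.
Context {R : realType}.

(** Writing [y = Z beta + (e - W beta)], the error [beta_hat - beta] solves the
    normal equation of [A = U^T Z] with right-hand side [U^T (e - W beta)]. *)
Lemma iv_estimator_bound n k m (X W : 'M[R]_(n, k)) (U : 'M[R]_(n, m))
    (e : 'cV[R]_n) (beta : 'cV[R]_k) (s : R) :
  0 < s -> (forall x, s * l2norm x <= l2norm ((U^T *m (X + W)) *m x)) ->
  Sigma_hat (X + W) U \in unitmx /\
  s * l2norm (beta_hat (X + W) U (X *m beta + e) - beta)
    <= l2norm (U^T *m e - (U^T *m W) *m beta).
Proof.
move=> s0 As; set Z := X + W in As *; set A := U^T *m Z in As.
have SE : Sigma_hat Z U = A^T *m A.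
  by rewrite /Sigma_hat /A trmx_mul trmxK !mulmxA.
have unitS : Sigma_hat Z U \in unitmx by rewrite SE; exact: (gram_unitmx s0 As).
split => //; apply: (normal_equation_bound As).
rewrite -SE mulmxBr /beta_hat mulKVmx// SE.
have -> : gamma_hat Z U (X *m beta + e) = A^T *m (U^T *m (X *m beta + e)).
  by rewrite /gamma_hat /A trmx_mul trmxK !mulmxA.
have -> : A^T *m A *m beta = A^T *m (A *m beta) by rewrite mulmxA.
rewrite -mulmxBr; congr (_ *m _).
rewrite /A /Z !mulmxDr !mulmxDl !mulmxA.
by rewrite opprD addrACA addrA subrr add0r.
Qed.

End Estimator.

(** * Measurability of the estimator *)

Section MeasurableMatrix.
Context {d : measure_display} {T : measurableType d} {R : realType}.

Lemma random_matrix_mul n q r (V : T -> 'M[R]_(n, q)) (U : T -> 'M[R]_(q, r)) :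
  random_matrix V -> random_matrix U -> random_matrix (fun w => V w *m U w).
Proof.
move=> mV mU i j; under eq_fun do rewrite mxE.
by apply: measurable_fun_bigsum => l; apply: measurable_funM; [exact: mV|exact: mU].
Qed.

Lemma random_matrix_add n q (V U : T -> 'M[R]_(n, q)) :
  random_matrix V -> random_matrix U -> random_matrix (fun w => V w + U w).
Proof.
move=> mV mU i j; under eq_fun do rewrite mxE.
by apply: measurable_funD; [exact: mV|exact: mU].
Qed.

Lemma random_matrix_tr n q (V : T -> 'M[R]_(n, q)) :
  random_matrix V -> random_matrix (fun w => (V w)^T).
Proof. by move=> mV i j; under eq_fun do rewrite mxE; exact: mV. Qed.

Lemma random_matrix_cst n q (A : 'M[R]_(n, q)) : random_matrix (fun _ : T => A).
Proof. by move=> i j; exact: measurable_cst. Qed.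

Lemma measurable_det q (V : T -> 'M[R]_q) :
  random_matrix V -> measurable_fun setT (fun w => \det (V w)).
Proof.
move=> mV; apply: measurable_fun_bigsum => s; apply: measurable_funM => //.
by apply: measurable_fun_bigprod => i; exact: mV.
Qed.

Lemma random_matrix_adj q (V : T -> 'M[R]_q) :
  random_matrix V -> random_matrix (fun w => \adj (V w)).
Proof.
move=> mV i j; under eq_fun do rewrite mxE.
rewrite /cofactor; apply: measurable_funM => //; apply: measurable_det => i' j'.
by under eq_fun do rewrite !mxE; exact: mV.
Qed.

Lemma measurable_l2norm q (V : T -> 'cV[R]_q) :
  random_matrix V -> measurable_fun setT (fun w => l2norm (V w)).
Proof.
move=> mV; apply: measurableT_comp => //.
  exact: (continuous_measurable_fun (@sqrt_continuous R)).
by apply: measurable_fun_bigsum => i; apply: measurable_funX; exact: mV.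
Qed.

(** Multiplying the error by the determinant removes the inverse, by Cramer's
    rule: what remains is polynomial in the entries of [S] and [g]. *)
Lemma measurable_estimator_event k (S : T -> 'M[R]_k) (g : T -> 'cV[R]_k)
    (beta : 'cV[R]_k) (r : R) :
  random_matrix S -> random_matrix g ->
  measurable [set w | S w \in unitmx /\ l2norm (invmx (S w) *m g w - beta) <= r].
Proof.
move=> mS mg; have mdet := measurable_det mS.
have -> : [set w | S w \in unitmx /\ l2norm (invmx (S w) *m g w - beta) <= r] =
    [set w | 0 < `|\det (S w)|] `&`
    [set w | l2norm (\adj (S w) *m g w + (- beta) *m (\det (S w))%:M) <=
             r * `|\det (S w)|].
  apply/seteqP; split => w /=; rewrite normr_gt0 unitmxE unitfE.
    move=> [d0]; rewrite /invmx unitmxE unitfE d0 -scalemxAl => h; split => //.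
    move: h; rewrite -(ler_pM2r (_ : 0 < `|\det (S w)|)) ?normr_gt0//.
    rewrite mulrC -l2normZ scalerBr scalerA mulfV// scale1r.
    by rewrite mul_mx_scalar scalerN.
  move=> [d0 h]; split => //; rewrite /invmx unitmxE unitfE d0 -scalemxAl.
  rewrite -(ler_pM2r (_ : 0 < `|\det (S w)|)) ?normr_gt0//.
  rewrite mulrC -l2normZ scalerBr scalerA mulfV// scale1r.
  by move: h; rewrite mul_mx_scalar scalerN.
have mnorm : measurable_fun setT (fun w => `|\det (S w)|).
  exact: measurableT_comp.
apply: measurableI.
  exact: measurable_lt_set.
rewrite -[X in measurable X]setTI; apply: measurable_fun_le => //; last first.
  by apply: measurable_funM.
apply: measurable_l2norm; apply: random_matrix_add.
  by apply: random_matrix_mul => //; exact: random_matrix_adj.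
move=> i j; under eq_fun do rewrite mul_mx_scalar mxE.
by apply: measurable_funM.
Qed.

End MeasurableMatrix.

(** * Consequences of the sub-Gaussian model *)

Section Interface.
Context {d : measure_display} {T : measurableType d} {R : realType}.
Variable P : probability T R.

Lemma mutually_independent3 (G0 G1 G2 : set (set T)) A0 A1 A2 :
  mutually_independent P (tnth [tuple G0; G1; G2]) -> G0 A0 -> G1 A1 -> G2 A2 ->
  (P (A0 `&` A1 `&` A2) = P A0 * P A1 * P A2)%E.
Proof.
move=> indG G0A G1A G2A; have := mutually_independentT indG (A:=tnth [tuple A0; A1; A2]).
move=> H; have {}H : (P (\bigcap_(i in [set: 'I_3]) tnth [tuple A0; A1; A2] i) =
    \prod_i P (tnth [tuple A0; A1; A2] i))%E.
  by apply: H => -[[|[|[|]]]].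
move: H; rewrite !big_ord_recl big_ord0 mule1 muleA => <-.
congr (P _); apply/seteqP; split => [x [[h0 h1] h2] [[|[|[|]]]]//|x h].
have h0 := h (inord 0) Logic.I; have h1 := h (inord 1) Logic.I.
have h2 := h (inord 2) Logic.I.
by rewrite !(tnth_nth setT) !inordK//= in h0 h1 h2.
Qed.

Lemma sigma_gen_row_mxr n q m (V : T -> 'M[R]_(n, q)) (U : T -> 'M[R]_(n, m)) :
  sigma_gen U `<=` sigma_gen (fun w => row_mx (V w) (U w)).
Proof.
apply: sigma_gen_sub => i j.
have -> : (fun w => U w i j) = (fun w => row_mx (V w) (U w) i (rshift q j)).
  by apply/funext => w; rewrite row_mxEr.
exact: (@sigma_gen_entry _ _ _ _ _ (fun w => row_mx (V w) (U w))).
Qed.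

Lemma sub_gaussian_mx_ge0 n q (V : T -> 'M[R]_(n, q)) Sigma s :
  (0 < n)%N -> (0 < q)%N -> sub_gaussian_mx P V Sigma s -> 0 <= s.
Proof.
move=> n0 q0 sV; have [t ts [_ _ t0 _]] := sgmx_tail sV (Ordinal n0) (l2norm_delta (Ordinal q0)).
by have := le_trans t0 ts; rewrite pmulr_lge0// invr_gt0 sqrtr_gt0 ltr0n.
Qed.

Lemma sub_gaussian_mx_rows n q (V : T -> 'M[R]_(n, q)) Sigma s :
  (0 < n)%N -> sub_gaussian_mx P V Sigma s -> sub_gaussian_rows P V s.
Proof.
move=> n0 sV i u u1 l; have nR0 : 0 < n%:R :> R by rewrite ltr0n.
have [->|u0] := eqVneq u 0.
  under eq_integral do rewrite mulmx0 mxE mulr0 expR0.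
  rewrite integral_cst//= probability_setT mule1 lee_fin -[leLHS]expR0 ler_expR.
  by rewrite divr_ge0// mulr_ge0// sqr_ge0.
have [t ts [_ _ t0 mgf]] := sgmx_tail sV i (l2norm_normalize u0).
have nu : 0 < l2norm u by exact: l2norm_gt0.
have := mgf (l * l2norm u); rewrite unlock.
have E w : l * l2norm u * (((l2norm u)^-1 *: u)^T *m (row i (V w))^T) ord0 ord0 =
    l * (V w *m u) i ord0.
  rewrite -trmx_mul mxE -row_mul mxE -scalemxAr mxE -mulrA mulVKf// gt_eqF//.
under eq_integral do rewrite E.
move=> /le_trans; apply; rewrite lee_fin ler_expR.
have t2 : t ^+ 2 <= s ^+ 2 / n%:R.
  have : t ^+ 2 <= (s / Num.sqrt n%:R) ^+ 2.
    by rewrite ler_pXn2r ?nnegrE// (le_trans t0).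
  by rewrite exprMn exprVn sqr_sqrtr// ltW.
have u2 : l2norm u ^+ 2 <= 1 by rewrite exprn_ile1// l2norm_ge0.
have -> : s ^+ 2 * l ^+ 2 / (2 * n%:R) = s ^+ 2 / n%:R * l ^+ 2 / 2.
  by field; rewrite gt_eqF.
rewrite ler_wpM2r// ler_pM ?sqr_ge0// exprMn -[leRHS]mulr1.
by rewrite ler_wpM2l// sqr_ge0.
Qed.

(** The products of entries are integrable because they are sub-exponential. The
    parameters are enlarged by 1 to make them positive, as standardization
    requires. *)
Lemma has_mean_cross0 n m k (V : T -> 'M[R]_(n, k)) (U : T -> 'M[R]_(n, m))
    SV SU sv su : (0 < n)%N ->
  sub_gaussian_mx P V SV sv -> sub_gaussian_mx P U SU su ->
  0 <= sv -> 0 <= su ->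
  (forall A B, sigma_gen V A -> sigma_gen U B -> (P (A `&` B) = P A * P B)%E) ->
  has_mean P (fun w => (U w)^T *m V w) 0.
Proof.
move=> n0 gV gU sv0 su0 VU j l.
have mV := sgmx_random gV; have mU := sgmx_random gU.
have sv1 : 0 < sv + 1 by rewrite ltr_wpDl.
have su1 : 0 < su + 1 by rewrite ltr_wpDl.
have rV : sub_gaussian_rows P V (sv + 1).
  by apply: sub_gaussian_rows_le (sub_gaussian_mx_rows n0 gV); rewrite sv0 lerDl ler01.
have rU : sub_gaussian_rows P U (su + 1).
  by apply: sub_gaussian_rows_le (sub_gaussian_mx_rows n0 gU); rewrite su0 lerDl ler01.
have entry q (Z : T -> 'M[R]_(n, q)) i (a : 'I_q) w :
    (Z w *m delta_mx a ord0 : 'cV_n) i ord0 = Z w i a.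
  by rewrite -colE mxE.
have E w : ((U w)^T *m V w) j l = \sum_i V w i l * U w i j.
  by rewrite mxE; apply: eq_bigr => i _; rewrite mxE mulrC.
rewrite unlock; under eq_integral do rewrite E -sumEFin.
have iVU i : P.-integrable setT (fun w => (V w i l * U w i j)%:E).
  have := @integrable_row_mul _ _ _ P n m k V U _ _ n0 su1 sv1 mV mU rV rU
    (delta_mx j ord0) (delta_mx l ord0) i.
  rewrite !l2norm_delta => /(_ (lexx _) (lexx _)).
  by under eq_fun do rewrite !entry mulrC.
have iV i : P.-integrable setT (fun w => (V w i l)%:E).
  pose c := Num.sqrt n%:R / (sv + 1).
  have c0 : c != 0 by rewrite gt_eqF// divr_gt0// sqrtr_gt0 ltr0n.
  have mX : measurable_fun setT (fun w => c * V w i l).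
    by apply: measurable_funM => //; exact: mV.
  pose K := square_bound + expR (1 ^+ 2 / 8) : R.
  have K1 : (\int[P]_w (expR ((c * V w i l) ^+ 2 / 8))%:E <= K%:E)%E.
    have ul : l2norm (delta_mx l ord0 : 'cV[R]_k) <= 1 by rewrite l2norm_delta.
    have := standardized_rows n0 i sv1 mV rV ul.
    under eq_integral do rewrite entry.
    by move=> /le_trans; apply; rewrite lee_fin lerDl expR_ge0.
  have K2 : (\int[P]_w (expR ((cst (1 : R) w) ^+ 2 / 8))%:E <= K%:E)%E.
    have -> : (fun w => (expR ((cst (1 : R) w) ^+ 2 / 8))%:E) =
        cst (expR (1 ^+ 2 / 8))%:E :> (T -> \bar R) by [].
    rewrite integral_cst//= probability_setT mule1 lee_fin lerDr.
    exact: square_bound_ge0.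
  have m1 : measurable_fun setT (cst (1 : R) : T -> R) by exact: measurable_cst.
  have iX := integrable_subexp (measurable_funM mX m1) (integral_expR_mul mX m1 K1 K2).
  pose X : T -> R := (fun w => c * V w i l) \* cst 1.
  have -> : (fun w => (V w i l)%:E) = (fun w => (c^-1)%:E * (EFin \o X) w)%E.
    by apply/funext => w; rewrite /X /= -EFinM mulr1 mulKf.
  by apply: integrableZl.
rewrite integral_sum//= mxE big1// => i _.
apply: (integral_eq0_indep VU) => //.
- exact: sigma_gen_measurable.
- exact: sigma_gen_measurable.
- exact: sigma_gen_entry.
- exact: sigma_gen_entry.
- exact: iV.
- exact: iVU.
- by have := sgmx_mean0 gV i l; rewrite unlock mxE.
Qed.

End Interface.

Section MeanCrossCovariance.
Context {d : measure_display} {T : measurableType d} {R : realType}.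
Variable P : probability T R.

(** The means of the standardized products are at most [8 * square_bound]. A zero
    [alpha] is approached from above. Applied to [Sigma_UX], this compares
    [sigma_k] with [sigma_u]. *)
Lemma mean_cross_norm n m k (V : T -> 'M[R]_(n, k)) (U : T -> 'M[R]_(n, m))
    (M : 'M[R]_(m, k)) (alpha : R) :
  (0 < n)%N -> 0 <= alpha ->
  random_matrix V -> random_matrix U ->
  sub_gaussian_rows P V 1 -> sub_gaussian_rows P U alpha ->
  has_mean P (fun w => (U w)^T *m V w) M ->
  forall x, l2norm x <= 1 -> l2norm (M *m x) <= 8 * square_bound * alpha.
Proof.
move=> n0 a0 mV mU sV sU UVM x x1.
have b0 : 0 <= 8 * square_bound :> R by rewrite mulr_ge0// square_bound_ge0.
have [->|y0] := eqVneq (M *m x) 0; first by rewrite l2norm0 mulr_ge0.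
have ny : 0 < l2norm (M *m x) by exact: l2norm_gt0.
have H a : alpha < a -> l2norm (M *m x) <= 8 * square_bound * a.
  move=> aa; have a'0 : 0 < a := le_lt_trans a0 aa.
  have sU' : sub_gaussian_rows P U a.
    by apply: sub_gaussian_rows_le sU; rewrite a0 ltW.
  have u1 : l2norm ((l2norm (M *m x))^-1 *: (M *m x)) <= 1.
    by rewrite l2norm_normalize.
  have := mean_cross_bound n0 a'0 ltr01 mV mU sV sU' UVM u1 x1.
  by rewrite mulr1 dotZl -l2norm_sqr expr2 mulKf// gt_eqF.
have [b1|b1] := eqVneq (8 * square_bound : R) 0.
  by have := H (alpha + 1); rewrite b1 !mul0r ltrDl ltr01 => /(_ isT).
have b2 : 0 < 8 * square_bound :> R by rewrite lt_neqAle eq_sym b1.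
rewrite -ler_pdivrMl//; apply/ler_addgt0Pr => eps eps0.
by rewrite ler_pdivrMl// H// ltrDl.
Qed.

End MeanCrossCovariance.

(** * The sample size and the accuracy of the estimator *)

Section Rate.
Context {R : realType}.
Variables (sk su sw L N c D : R).
Hypotheses (sk0 : 0 < sk) (su0 : 0 < su) (N0 : 0 < N) (L0 : 0 <= L).
Hypothesis sample : c * (su ^+ 2 * (1 + sw ^+ 2)) * L <= N * sk ^+ 2.

(** This is the square root of the condition [sample]; it serves for [v = 1] and
    for [v = sw], the parameters of [X] and [W]. *)
Lemma deviation_le_quarter v : 0 <= D -> 0 <= v -> v ^+ 2 <= 1 + sw ^+ 2 ->
  16 * D ^+ 2 <= c ->
  D * (su * v) * Num.sqrt (L / N) <= sk / 4.
Proof.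
move=> D0 v0 vw Dc.
rewrite -(@ler_pXn2r _ 2%N)// ?nnegrE.
- rewrite !exprMn sqr_sqrtr ?divr_ge0 ?(ltW N0)//.
  rewrite [leLHS]mulrA ler_pdivrMr//.
  have h1 : 0 <= su ^+ 2 * (1 + sw ^+ 2) * L.
    by rewrite mulr_ge0// mulr_ge0 ?sqr_ge0// addr_ge0// sqr_ge0.
  have h2 := ler_wpM2r h1 Dc.
  have h3 : 0 <= 16 * D ^+ 2 * (su ^+ 2 * L) by apply: mulr_ge0; apply: mulr_ge0 => //; exact: sqr_ge0.
  have h4 := ler_wpM2l h3 vw.
  have := sample; lra.
- by rewrite mulr_ge0 ?sqrtr_ge0// mulr_ge0// mulr_ge0// ltW.
- by rewrite divr_ge0// ltW.
Qed.

(** As [sk <= b * su], the ratio [(su / sk) ^ 2] in the condition [sample] is at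
    least [b ^ -2]. *)
Lemma sample_size_le (b : R) : 0 < b -> sk <= b * su -> 256 * b ^+ 2 <= c ->
  256 * L <= N.
Proof.
move=> b0 skb bc.
have h1 : sk ^+ 2 <= b ^+ 2 * su ^+ 2.
  rewrite -exprMn ler_pXn2r// nnegrE; first exact: ltW.
  by rewrite mulr_ge0// ltW.
have b2 : 0 < b ^+ 2 * su ^+ 2 by rewrite mulr_gt0 ?exprn_gt0.
have h2 := ler_wpM2l (ltW N0) h1.
have h3 : 256 * b ^+ 2 * (su ^+ 2 * L) <= c * (su ^+ 2 * L).
  by rewrite ler_wpM2r// mulr_ge0// sqr_ge0.
have c0 : 0 <= c by apply: le_trans bc; rewrite mulr_ge0// sqr_ge0.
have h4 : 0 <= c * (su ^+ 2 * sw ^+ 2 * L).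
  by rewrite mulr_ge0// mulr_ge0// mulr_ge0 ?sqr_ge0.
rewrite -(ler_pM2r b2); have := sample; lra.
Qed.

End Rate.

Lemma addr_le_sqrt (R : realType) (a b : R) : 0 <= a -> 0 <= b ->
  a + b <= 2 * Num.sqrt (a ^+ 2 + b ^+ 2).
Proof.
move=> a0 b0; have h : 0 <= a ^+ 2 + b ^+ 2 by rewrite addr_ge0 ?sqr_ge0.
rewrite -(@ler_pXn2r _ 2%N)// ?nnegrE ?addr_ge0 ?mulr_ge0 ?sqrtr_ge0//.
by rewrite exprMn sqr_sqrtr//; have := sqr_ge0 (a - b); nra.
Qed.

Theorem corollary14 (R : realType) :
  exists c C C1 C2 : R, [/\ 0 < c, 0 < C, 0 < C1, 0 < C2 &
    forall (d : measure_display) (T : measurableType d) (P : probability T R)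
      (n k m p : nat)
      (X W : T -> 'M[R]_(n, k)) (e : T -> 'cV[R]_n) (U : T -> 'M[R]_(n, m))
      (Sigma_x Sigma_w : 'M[R]_k) (Sigma_U : 'M[R]_m)
      (Sigma_UX : 'M[R]_(m, k)) (sigma sigma_w sigma_e sigma_u : R)
      (beta : 'cV[R]_k),
    let y := fun w => X w *m beta + e w in
    let Z := fun w => X w + W w in
    let sigma_1 := singular_value Sigma_UX 1 in
    let sigma_k := singular_value Sigma_UX k in
    sub_gaussian_design P X W e Sigma_x Sigma_w sigma sigma_w sigma_e ->
    (k <= m)%N ->
    sub_gaussian_mx P U Sigma_U sigma_u ->
    has_mean P (fun w => (U w)^T *m X w) Sigma_UX ->
    independent_rows P (fun w => row_mx (X w) (U w)) ->
    mutually_independent P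
      (tnth [tuple sigma_gen (fun w => row_mx (X w) (U w));
                   sigma_gen W; sigma_gen e]) ->
    0 < sigma_k ->
    (k <= p)%N ->
    c * Num.max 1 (sigma_u ^+ 2 * (1 + sigma_w ^+ 2)
                     / (k%:R / m%:R * sigma_k ^+ 2))
      * k%:R * ln p%:R <= n%:R ->
    ((1 - C1 * p%:R `^ (- C2))%:E <=
      P [set w | Sigma_hat (Z w) (U w) \in unitmx /\
          (l2norm (beta_hat (Z w) (U w) (y w) - beta)
            <= C * Num.sqrt (sigma_w ^+ 2 * l2norm beta ^+ 2 + sigma_e ^+ 2)
               * (sigma_1 * sigma_u / (sigma_k ^+ 2 * Num.sqrt (k%:R / m%:R)))
               * Num.sqrt (k%:R * ln p%:R / n%:R))%R])%E].
Proof.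
pose b : R := 8 * square_bound; pose D : R := 4 * deviation_const.
have D0 : 0 < D by apply: mulr_gt0; [rewrite ltr0n|exact: deviation_const_gt0].
(* 256 b^2 gives n >= 256 m ln p, and 16 D^2 makes the deviations at most sigma_k / 4. *)
pose c : R := 1 + (256 * b ^+ 2 + 16 * D ^+ 2).
have b20 : 0 <= 256 * b ^+ 2 by apply: mulr_ge0; [exact: ler0n|exact: sqr_ge0].
have D20 : 0 <= 16 * D ^+ 2 by apply: mulr_ge0; [exact: ler0n|exact: sqr_ge0].
have c0 : 0 < c by apply: ltr_pwDl; [exact: ltr01|exact: addr_ge0].
have bc : 256 * b ^+ 2 <= c by rewrite /c; lra.
have Dc : 16 * D ^+ 2 <= c by rewrite /c; lra.
clearbody c.
exists c, (4 * D), 3, 1; split => //.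
  by apply: mulr_gt0; [rewrite ltr0n|].
move=> d T P n k m p X W e U Sx Sw SU M sigma sw se su beta y Z s1 sk.
move=> [gX gW ge _] km gU UXM indXU indep sk0 kp hn.
have k0 : (0 < k)%N.
  rewrite lt0n; apply/eqP => k0; move: sk0.
  rewrite /sk /singular_value nth_default ?sqrtr0 ?ltxx//.
  by apply: leq_trans (size_eigenvalues _) _; rewrite k0.
have m0 : (0 < m)%N := leq_trans k0 km.
rewrite powR_inv1//.
(* For p = 1 the claimed lower bound is 1 - 3 < 0. *)
have [p1|p2] := leqP p 1.
  apply: (@le_trans _ _ 0%E); last exact: measure_ge0.
  have -> : p = 1%N by apply/eqP; rewrite eqn_leq p1 (leq_trans k0).
  by rewrite lee_fin subr_le0 invr1 mulr1 ler1n.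
have lnp : 0 < ln p%:R :> R by rewrite ln_gt0// ltr1n.
have kR : 0 < k%:R :> R by rewrite ltr0n.
have mR : 0 < m%:R :> R by rewrite ltr0n.
have nR : 0 < n%:R :> R.
  apply: lt_le_trans hn; rewrite mulr_gt0// mulr_gt0// mulr_gt0//.
  by rewrite lt_max ltr01.
have n0 : (0 < n)%N by rewrite ltr0n in nR.
have su_ge0 := sub_gaussian_mx_ge0 n0 m0 gU.
have sw_ge0 := sub_gaussian_mx_ge0 n0 k0 gW.
have se_ge0 := sub_gaussian_mx_ge0 n0 (ltn0Sn 0) ge.
have rX := sub_gaussian_mx_rows n0 gX.
have rW := sub_gaussian_mx_rows n0 gW.
have re := sub_gaussian_mx_rows n0 ge.
have rU := sub_gaussian_mx_rows n0 gU.
have [mX mW me mU] := And4 (sgmx_random gX) (sgmx_random gW) (sgmx_random ge) (sgmx_random gU).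
have [Mlow s1k] := singular_value_last k0 sk0.
rewrite -/sk in Mlow s1k.
have skb : sk <= b * su.
  have e1 : l2norm (delta_mx (Ordinal k0) ord0 : 'cV[R]_k) <= 1.
    by rewrite l2norm_delta.
  apply: le_trans (mean_cross_norm n0 su_ge0 mX mU rX rU UXM e1).
  by have := Mlow (delta_mx (Ordinal k0) ord0); rewrite l2norm_delta mulr1.
have b_gt0 : 0 < b.
  by rewrite ltNge; apply/negP => b0; move: (lt_le_trans sk0 skb); rewrite ltNge mulr_le0_ge0.
have su0 : 0 < su by have := lt_le_trans sk0 skb; rewrite pmulr_rgt0.
pose L := m%:R * ln p%:R : R.
have L0 : 0 <= L by rewrite mulr_ge0// ltW.
have sample : c * (su ^+ 2 * (1 + sw ^+ 2)) * L <= n%:R * sk ^+ 2.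
  rewrite -ler_pdivrMr ?exprn_gt0//; apply: le_trans hn.
  have -> : c * (su ^+ 2 * (1 + sw ^+ 2)) * L / sk ^+ 2 =
     c * (su ^+ 2 * (1 + sw ^+ 2) / (k%:R / m%:R * sk ^+ 2)) * k%:R * ln p%:R.
    by rewrite /L; field; rewrite !gt_eqF.
  rewrite ler_pM2r// ler_pM2r// ler_pM2l// le_max lexx orbT//.
have nL := sample_size_le sk0 su0 nR L0 sample b_gt0 skb bc.
have eT : sigma_gen e setT by exact: sigma_gen_setT.
have WT : sigma_gen W setT by exact: sigma_gen_setT.
have indWU A B : sigma_gen W A -> sigma_gen U B -> (P (A `&` B) = P A * P B)%E.
  move=> WA UB; have UB' := sigma_gen_row_mxr (V:=X) UB.
  have := mutually_independent3 indep UB' WA eT.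
  by rewrite setIT probability_setT mule1 setIC muleC.
have indeU A B : sigma_gen e A -> sigma_gen U B -> (P (A `&` B) = P A * P B)%E.
  move=> eA UB; have UB' := sigma_gen_row_mxr (V:=X) UB.
  have := mutually_independent3 indep UB' WT eA.
  by rewrite setIT probability_setT mule1 setIC muleC.
(* U^T X, U^T W and U^T e have means Sigma_UX, 0 and 0. *)
have [E1 [mE1 PE1 HE1]] := cross_covariance_concentration n0 m0 km p2 nL su0 ler01
  mX mU rX rU UXM indXU.
have [E2 [mE2 PE2 HE2]] := cross_covariance_concentration n0 m0 km p2 nL su0 sw_ge0
  mW mU rW rU (has_mean_cross0 n0 gW gU sw_ge0 su_ge0 indWU)
  (independent_rows_row_mx mW mU (sgmx_rows gW) (sgmx_rows gU) indWU).
have [E3 [mE3 PE3 HE3]] := cross_covariance_concentration n0 m0 m0 p2 nL su0 se_ge0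
  me mU re rU (has_mean_cross0 n0 ge gU se_ge0 su_ge0 indeU)
  (independent_rows_row_mx me mU (sgmx_rows ge) (sgmx_rows gU) indeU).
set r := 4 * D * _ * _ * _.
set event := [set w | _].
have mZ : random_matrix Z by exact: random_matrix_add.
have my : random_matrix y.
  by apply: random_matrix_add => //; apply: random_matrix_mul => //; exact: random_matrix_cst.
have mZUU : random_matrix (fun w => (Z w)^T *m U w *m (U w)^T).
  exact: (random_matrix_mul (random_matrix_mul (random_matrix_tr mZ) mU) (random_matrix_tr mU)).
have mevent : measurable event.
  by apply: measurable_estimator_event; exact: (random_matrix_mul mZUU).
pose dev := Num.sqrt (L / n%:R).
have dev0 : 0 <= dev := sqrtr_ge0 _.
have DE v : 4 * (deviation_const * (su * v) * dev) = D * (su * v) * dev.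
  by rewrite /D; ring.
have q1 : D * (su * 1) * dev <= sk / 4.
  by apply: (deviation_le_quarter sk0 su0 nR L0 sample) => //; rewrite ?(ltW D0)// expr1n lerDl sqr_ge0.
have q2 : D * (su * sw) * dev <= sk / 4.
  by apply: (deviation_le_quarter sk0 su0 nR L0 sample) => //; rewrite ?(ltW D0)// lerDr.
have sub : E1 `&` E2 `&` E3 `<=` event.
  move=> w [[w1 w2] w3]; rewrite /event /=.
  have h1 x : l2norm (((U w)^T *m X w - M) *m x) <= sk / 4 * l2norm x.
    apply: le_trans (HE1 w w1 x) _; rewrite ler_wpM2r ?l2norm_ge0//.
    by rewrite -/L -/dev DE.
  have h2' x : l2norm (((U w)^T *m W w) *m x) <= D * (su * sw) * dev * l2norm x.
    by have := HE2 w w2 x; rewrite subr0 -/L -/dev DE.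
  have h2 x : l2norm (((U w)^T *m W w) *m x) <= sk / 4 * l2norm x.
    by apply: le_trans (h2' x) _; rewrite ler_wpM2r ?l2norm_ge0.
  have h3 : l2norm ((U w)^T *m e w) <= D * (su * se) * dev.
    have := HE3 w w3 1%:M; rewrite subr0 mulmx1 -/L -/dev DE.
    have -> : l2norm (1%:M : 'cV[R]_1) = 1.
      by rewrite /l2norm big_ord1 mxE eqxx expr1n sqrtr1.
    by rewrite mulr1.
  have low x : sk / 2 * l2norm x <= l2norm ((U w)^T *m (X w + W w) *m x).
    set a := ((U w)^T *m X w - M) *m x; set a' := ((U w)^T *m W w) *m x.
    have E : M *m x = (U w)^T *m (X w + W w) *m x + (-1) *: (a + a').
      rewrite /a /a' mulmxBl mulmxDr mulmxDl scaleN1r.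
      by rewrite [X in _ - X]addrAC opprB addrCA subrr addr0.
    have := Mlow x; rewrite {1}E => h.
    have t1 := l2norm_triangle ((U w)^T *m (X w + W w) *m x) ((-1) *: (a + a')).
    have t2 := l2norm_triangle a a'.
    move: t1; rewrite l2normZ normrN1 mul1r => t1.
    have := h1 x; have := h2 x; rewrite -/a -/a'; lra.
  have sk2 : 0 < sk / 2 by rewrite divr_gt0.
  have [unitS bnd] := iv_estimator_bound (e w) beta sk2 low.
  split; first exact: unitS.
  set h := l2norm _ in bnd *.
  set S := Num.sqrt (sw ^+ 2 * l2norm beta ^+ 2 + se ^+ 2).
  have vb : l2norm ((U w)^T *m e w - (U w)^T *m W w *m beta) <= D * su * dev * (2 * S).
    have t := l2norm_triangle ((U w)^T *m e w) ((-1) *: ((U w)^T *m W w *m beta)).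
    move: t; rewrite l2normZ normrN1 mul1r scaleN1r => t.
    have t2 := h2' beta.
    have t3 := addr_le_sqrt (mulr_ge0 sw_ge0 (l2norm_ge0 beta)) se_ge0.
    rewrite exprMn -/S in t3.
    have Ds : 0 <= D * su * dev by rewrite mulr_ge0// mulr_ge0// ltW.
    have := ler_wpM2l Ds t3; lra.
  have rE : r = (4 * D * S * su * dev / sk) * (s1 / sk).
    rewrite /r -/S.
    have -> : k%:R * ln p%:R / n%:R = k%:R / m%:R * (L / n%:R) :> R.
      by rewrite /L; field; rewrite !gt_eqF.
    rewrite [Num.sqrt (k%:R / m%:R * _)]sqrtrM ?divr_ge0 ?(ltW kR) ?(ltW mR)// -/dev.
    have km0 : 0 < Num.sqrt (k%:R / m%:R) :> R by rewrite sqrtr_gt0 divr_gt0.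
    by field; rewrite !gt_eqF.
  have hb : h <= 4 * D * S * su * dev / sk.
    rewrite ler_pdivlMr//; have := le_trans bnd vb; lra.
  apply: le_trans hb _; rewrite rE ler_peMr//.
    apply: divr_ge0; last exact: ltW.
    do 2! apply: mulr_ge0 => //; apply: mulr_ge0; last exact: sqrtr_ge0.
    by apply: mulr_ge0; [exact: ler0n|exact: ltW].
  by rewrite ler_pdivlMr// mul1r.
have mE : measurable (E1 `&` E2 `&` E3) by apply: measurableI => //; exact: measurableI.
apply: (@le_trans _ _ (P (E1 `&` E2 `&` E3))); last first.
  by apply: le_measure; rewrite ?inE.
have -> : P (E1 `&` E2 `&` E3) = (1 - P (~` (E1 `&` E2 `&` E3)))%E.
  by rewrite -probability_setC ?setCK//; exact: measurableC.
rewrite EFinB leeB//.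
have -> : (3 * p%:R^-1)%:E = ((p%:R^-1 : R)%:E + (p%:R^-1)%:E + (p%:R^-1)%:E)%E.
  by rewrite -!EFinD; congr (_%:E); ring.
have mC1 := measurableC mE1; have mC2 := measurableC mE2; have mC3 := measurableC mE3.
rewrite !setCI; apply: (@le_trans _ _ (P (~` E1 `|` ~` E2) + P (~` E3))%E).
  by apply: measureU2 => //; exact: measurableU.
rewrite leeD//; apply: (@le_trans _ _ (P (~` E1) + P (~` E2))%E).
  exact: measureU2.
by rewrite leeD.
Qed.
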